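(* Let $W$ be a finite Coxeter group of rank $n$ with exponents $m_1,\dots,m_n$, let $w_0$ be the longest element of $W$, and let $x\ne0$ be real. Then $$M_{W,x}(w_0)=\frac{\prod_{i=1}^n(x-m_i)}{x^n|W|}.$$
   Context: Let $W$ be a finite Coxeter group acting on its reflection representation $V$, with a root system and a set $\Pi$ of simple (fundamental) roots, $n=|\Pi|$. For $w\in W$ let $D(w)\subseteq\Pi$ be the set of simple roots mapped by $w$ to negative roots. For $J\subseteq\Pi$ let $X_J=\{w\in W: D(w)\cap J=\emptyset\}$ and $x_J=\sum_{w\in X_J}w$ in the group algebra of $W$. Call $K_1,K_2\subseteq\Pi$ equivalent if $w(K_1)=K_2$ for some $w\in W$; let $\lambda$ range over equivalence classes of subsets of $\Pi$, let $\lambda_K$ be the class of $K$, let $|\lambda|$ be the number of subsets in $\lambda$, and let $\|\lambda\|=|K|$ for any $K\in\lambda$. For $K\subseteq J\subseteq \Pi$ put $\mu_K^J=\frac{|\{w\in X_J: w(K)\subseteq\Pi\}|}{|\lambda_K|}$, and $\mu_K^J=0$ if $K\not\subseteq J$. The matrix $(\mu_K^J)$ is triangular with respect to inclusion with nonzero diagonal, hence invertible; let $(\beta_K^J)$ be its inverse. Define $$e_J=\sum_{K\subseteq J}\beta_K^J x_K,\qquad e_\lambda=\sum_{J\in\lambda}\frac{e_J}{|\lambda|}$$ (equivalently, the $e_J$ are determined by $x_J=\sum_{K\subseteq J}\mu_K^J e_K$ for all $J\subseteq\Pi$). For real $x\ne 0$ define $$M_{W,x}=\sum_{\lambda}\frac{e_\lambda}{x^{\|\lambda\|}},$$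 and let $M_{W,x}(w)$ be the coefficient of $w$ in $M_{W,x}$. The exponents of $W$ are the degrees of its basic polynomial invariants minus one. *)

(* Defs.v *)
From HB Require Import structures.
From mathcomp Require Import all_boot all_order all_algebra all_fingroup.
From mathcomp Require Import mxrepresentation reals.
From mathcomp Require Import mpoly.

Set Implicit Arguments.
Unset Strict Implicit.
Unset Printing Implicit Defensive.

Import GRing.Theory.
Local Open Scope ring_scope.

Section CoxeterSystem.
Variables (W : finGroupType) (n : nat) (s : 'I_n -> W).

(* W has the Coxeter presentation < s_i | (s_i s_j)^m_ij = 1 >, m_ij being the
   order of s_i s_j; the last field is the universal property of this
   presentation, tested on all (possibly infinite) groups. *)
Record coxeter_system : Prop := CoxeterSystem {
  cox_inj : injective s;
  cox_involution : forall i, #[s i]%g = 2%N;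
  cox_generated : <<[set s i | i : 'I_n]>>%g = [set: W];
  cox_presented : forall (H : groupType) (f : 'I_n -> H),
    (forall i j, ((f i * f j) ^+ #[s i * s j])%g = 1%g) ->
    exists phi : W -> H,
      (forall u v, phi (u * v)%g = (phi u * phi v)%g) /\
      (forall i, phi (s i) = f i)
}.

(* Least k such that w is a product of k of the s_i; if the s_i generate W,
   then such a k exists below #|W|, since the prefixes of a shortest word
   represent distinct elements. *)
Definition cox_length (w : W) : nat :=
  find (fun k => [exists t : k.-tuple 'I_n, w == (\prod_(i <- t) s i)%g])
       (iota 0 #|W|).

Definition longest (w0 : W) : Prop :=
  forall w, (cox_length w <= cox_length w0)%N.

End CoxeterSystem.

Section RootSystem.
Variables (R : realType) (n : nat).
Implicit Types (u v a b : 'cV[R]_n) (Phi : seq 'cV[R]_n).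

Definition dot u v : R := \sum_i u i 0 * v i 0.

Definition reflection a v : 'cV[R]_n := v - (2 * dot v a / dot a a) *: a.

Record root_system Phi : Prop := RootSystem {
  root_neq0 : 0 \notin Phi;
  root_line : forall a (c : R), a \in Phi ->
    (c *: a \in Phi) = (c == 1) || (c == -1);
  root_stable : forall a b, a \in Phi -> b \in Phi -> reflection a b \in Phi
}.

Definition pos_root Phi (Pi : n.-tuple 'cV[R]_n) v : bool :=
  (v \in Phi) && [forall i, 0 <= coord Pi i v].

Definition neg_root Phi (Pi : n.-tuple 'cV[R]_n) v : bool :=
  (v \in Phi) && [forall i, coord Pi i v <= 0].

Record simple_system Phi (Pi : n.-tuple 'cV[R]_n) : Prop := SimpleSystem {
  simple_basis : basis_of fullv Pi;
  simple_root : {subset Pi <= Phi};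
  simple_sign : forall v, v \in Phi -> pos_root Phi Pi v || neg_root Phi Pi v
}.

End RootSystem.

Section ReflectionRepresentation.
Variables (R : realType) (n : nat) (W : finGroupType).
Variable rho : mx_representation R [set: W] n.

(* W acts on the left, on column vectors. *)
Definition act (w : W) (v : 'cV[R]_n) : 'cV[R]_n := rho w *m v.

Record reflection_representation (s : 'I_n -> W) (Phi : seq 'cV[R]_n)
    (Pi : n.-tuple 'cV[R]_n) : Prop := ReflectionRepresentation {
  refl_root_system : root_system Phi;
  refl_simple_system : simple_system Phi Pi;
  refl_faithful : mx_faithful rho;
  refl_simple : forall i v, act (s i) v = reflection (tnth Pi i) v
}.

(* p is constant on W-orbits: p (w v) = p v as polynomials in v. *)
Definition invariant_poly (p : {mpoly R[n]}) : Prop :=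
  forall w : W, p \mPo [tuple \sum_j rho w i j *: 'X_j | i < n] = p.

Record basic_invariants (f : n.-tuple {mpoly R[n]}) : Prop :=
  BasicInvariants {
  basic_invariant : forall i, invariant_poly (tnth f i);
  basic_generate : forall p, invariant_poly p ->
    exists q : {mpoly R[n]}, p = q \mPo f;
  basic_independent : forall q : {mpoly R[n]}, q \mPo f = 0 -> q = 0
}.

Definition exponents (m : 'I_n -> nat) : Prop :=
  exists f : n.-tuple {mpoly R[n]},
    basic_invariants f /\ (forall i, tnth f i \is (m i).+1.-homog).

End ReflectionRepresentation.

(* The group algebra of W over R is {ffun W -> R^o}. Subsets of Pi are given by
   the sets of their indices in 'I_n. *)
Section DescentAlgebra.
Variables (R : realType) (n : nat) (W : finGroupType).
Variables (rho : mx_representation R [set: W] n).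
Variables (Phi : seq 'cV[R]_n) (Pi : n.-tuple 'cV[R]_n).
Implicit Types (w : W) (J K : {set 'I_n}) (lam : {set {set 'I_n}}).

Definition descents w : {set 'I_n} :=
  [set i | neg_root Phi Pi (act rho w (tnth Pi i))].

Definition X_ J : {set W} := [set w | descents w :&: J == set0].

Definition gelt w : {ffun W -> R^o} := [ffun u => (u == w)%:R].

Definition x_ J : {ffun W -> R^o} := \sum_(w in X_ J) gelt w.

Definition simple_equiv : rel {set 'I_n} := fun K1 K2 =>
  [exists w : W, perm_eq [seq act rho w (tnth Pi i) | i in K1]
                         [seq tnth Pi i | i in K2]].

Definition simple_classes : {set {set {set 'I_n}}} :=
  equivalence_partition simple_equiv [set: {set 'I_n}].

Definition class_of K : {set {set 'I_n}} := [set L | simple_equiv K L].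

(* The cardinality of any member of lam (0 on the empty set, which is not a
   class). *)
Definition class_rank lam : nat :=
  if [pick K in lam] is Some K then #|K| else 0%N.

Definition mu K J : R :=
  if K \subset J then
    #|[set w in X_ J | [forall i in K, act rho w (tnth Pi i) \in Pi]]|%:R
      / #|class_of K|%:R
  else 0.

Definition mu_mx : 'M[R]_#|{set 'I_n}| :=
  \matrix_(k, j) mu (enum_val k) (enum_val j).

Definition beta K J : R := invmx mu_mx (enum_rank K) (enum_rank J).

Definition e_ J : {ffun W -> R^o} :=
  \sum_(K : {set 'I_n} | K \subset J) beta K J *: x_ K.

Definition e_class lam : {ffun W -> R^o} :=
  \sum_(J in lam) (#|lam|%:R)^-1 *: e_ J.

Definition M_ (x : R) : {ffun W -> R^o} :=
  \sum_(lam in simple_classes) (x ^+ class_rank lam)^-1 *: e_class lam.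

End DescentAlgebra.

(* Main.v *)
From HB Require Import structures.
From mathcomp Require Import all_boot all_order all_algebra all_fingroup.
From mathcomp Require Import mxrepresentation reals boolp complex.
From mathcomp Require Import mpoly ring.
Require Import Defs.

(* Only x_{} has w0 in its support, so M(w0) = sum_J beta_{}^J / (|lambda_J| x^|J|).
   Say that w has type K when it is conjugate to an element of W_K whose fixed
   space is the orthogonal of K.  For w of type T, the number of v in X_J with
   v^-1 w v in W_J is the sum of mu_K^J over the K <= J equivalent to T.  Since
   the determinant sums to 0 over W_J for nonempty J, it follows that
   b_K = |W|^-1 sum_(w of type ~ K) det w satisfies sum_K b_K mu_K^J = [J = {}];
   hence b = beta_{} and M(w0) = |W|^-1 sum_w det(w) x^(- codim Fix w).

   It remains to prove the Shephard-Todd formula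
     sum_w T^(dim Fix w) = prod_i (T + m_i).
   Let D be the Jacobian matrix of the basic invariants and Delta = det D.  As
   D(x) = D(w x) w, the Leibniz expansion of
     det (u D(x) + D(w x)) = det(w) det(1 + u w) Delta(x)
   writes sum_w det(1 + u w) (p |-> p(w x)) as a combination of operators
   p |-> c L(d p), where L is antisymmetrization divided by Delta.  Taking traces in
   each degree and using their cyclicity (and Molien's series for the trace of
   w) gives
     sum_w det(1 + u w) / det(1 - t w)
       = prod_i (1 + u t^m_i) * sum_w 1 / det(1 - t w);
   now put u = T (1 - t) - 1 and let t tend to 1.

   That Delta divides every skew polynomial is seen as follows: the product of the
   linear forms of the mirrors does, and it has the degree of Delta, as one sees by
   comparing F(t) = sum_w 1 / det(1 - t w) = |W| / prod_i (1 - t^(m_i + 1)) with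
   F(1/t). *)

Set Implicit Arguments.
Unset Strict Implicit.
Unset Printing Implicit Defensive.

Import Order.TTheory GRing.Theory Num.Theory.
Local Open Scope ring_scope.

(** * Graded traces and linear substitutions *)

(** The Shephard-Todd formula usually comes from Solomon's theorem that the invariant differential
    forms are free over the invariant polynomials, with the products of the d f_i as a basis. Here
    only traces are compared: the set [I] of rows taken from u D(x) in the Leibniz expansion plays
    the role of such a product, and no structure of the forms has to be proved. Infinite series
    never occur. A series is known by its truncations; identities between rational functions are
    stated for the real t with t^2 <> 1, since 1 and -1 are the only possible real eigenvalues of an
    orthogonal matrix; and the limit at t = 1 is an evaluation once denominators are cleared. On the
    Coxeter side, counting the v in X_J with v^-1 w v in W_J is counting the fixed points of w on W
    / W_J. Its sum against the determinant is an instance of Frobenius reciprocity: the determinant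
    occurs in this permutation character only if it is trivial on W_J, that is, if J is empty. *)

Section GradedTrace.
Variable R : nzRingType.

(** When all weights are positive, a monomial of weight [e] has degree at most [e], so the finite
    type of monomials of degree below [e.+1] contains all of them. *)
Definition monomials n (mf : measure n) e : seq 'X_{1..n} :=
  [seq bmnm m | m <- enum [pred m : 'X_{1..n < e.+1} | mf m == e]].

(** The weight [mf] is a parameter because two gradings meet: the degree in the coordinates and, for
    polynomials in the basic invariants, [degree_weight]. *)
Definition gtrace n (mf : measure n) e (T : {mpoly R[n]} -> {mpoly R[n]}) : R :=
  \sum_(m <- monomials mf e) (T 'X_[m])@_m.

Definition positive n (mf : measure n) := forall i, (0 < mf U_(i)%MM)%N.

Lemma mdeg_positive n : positive (@mdeg n).
Proof. by move=> i; rewrite /= mdeg1. Qed.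

Lemma monomials_uniq n (mf : measure n) e : uniq (monomials mf e).
Proof. by rewrite map_inj_uniq ?enum_uniq //; apply: val_inj. Qed.

Lemma mem_monomials n (mf : measure n) e m :
  positive mf -> (m \in monomials mf e) = (mf m == e).
Proof.
move=> mf_gt0; apply/mapP/idP => [[m'] | /eqP mfm].
  by rewrite mem_enum => mfm' ->.
have le_m : (mdeg m < e.+1)%N.
  rewrite ltnS -mfm mfE mdegE leq_sum // => i _.
  by rewrite leq_pmulr.
by exists (BMultinom le_m) => //; rewrite mem_enum inE mfm.
Qed.

Lemma dhomog_expand n (mf : measure n) e (p : {mpoly R[n]}) : positive mf ->
  p \is e.-homog for mf -> p = \sum_(m <- monomials mf e) p@_m *: 'X_[m].
Proof.
move=> mf_gt0 /dhomogP hp; apply/mpolyP => m; rewrite linear_sum /=.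
have [me|nme] := boolP (m \in monomials mf e).
  rewrite (bigD1_seq m) ?monomials_uniq //= mcoeffZ mcoeffX eqxx mulr1.
  by rewrite big1 ?addr0 // => i ne; rewrite mcoeffZ mcoeffX (negPf ne) mulr0.
rewrite big1_seq => [|i /= ie]; last first.
  rewrite mcoeffZ mcoeffX; case: eqP => [eim|]; last by rewrite mulr0.
  by rewrite -eim ie in nme.
apply: memN_msupp_eq0; apply: contra nme => /hp mfm.
by rewrite mem_monomials // mfm.
Qed.

Lemma eq_gtrace n (mf : measure n) e (T U : {mpoly R[n]} -> {mpoly R[n]}) :
  T =1 U -> gtrace mf e T = gtrace mf e U.
Proof. by move=> eqTU; apply: eq_bigr => m _; rewrite eqTU. Qed.

Lemma gtrace_sum n (mf : measure n) e I (r : seq I) (P : pred I) (T : I -> _) :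
  gtrace mf e (fun p => \sum_(i <- r | P i) T i p) =
  \sum_(i <- r | P i) gtrace mf e (T i).
Proof.
rewrite /gtrace exchange_big; apply: eq_bigr => m _.
by rewrite raddf_sum.
Qed.

Lemma gtraceZ n (mf : measure n) e a T :
  gtrace mf e (fun p => a *: T p) = a * gtrace mf e T.
Proof. by rewrite mulr_sumr; apply: eq_bigr => m _; rewrite mcoeffZ. Qed.

End GradedTrace.

Section GradedTraceCyclic.
Variable R : comNzRingType.

(** In monomial bases both traces are the same double sum. The two spaces may carry different
    gradings, as when [average] is factored through polynomials in the invariants. *)
Lemma gtrace_cyclic n n' (mf : measure n) (mf' : measure n') e e'
    (T : {linear {mpoly R[n']} -> {mpoly R[n]}})
    (U : {linear {mpoly R[n]} -> {mpoly R[n']}}) :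
  positive mf -> positive mf' ->
  (forall p, p \is e.-homog for mf -> U p \is e'.-homog for mf') ->
  (forall p, p \is e'.-homog for mf' -> T p \is e.-homog for mf) ->
  gtrace mf e (fun p => T (U p)) = gtrace mf' e' (fun p => U (T p)).
Proof.
move=> mf0 mf0' hU hT; rewrite /gtrace.
have trE a b (f : measure a) (g : measure b) d d'
    (V : {linear {mpoly R[b]} -> {mpoly R[a]}})
    (V' : {linear {mpoly R[a]} -> {mpoly R[b]}}) :
  positive f -> positive g ->
  (forall p, p \is d.-homog for f -> V' p \is d'.-homog for g) ->
  \sum_(m <- monomials f d) (V (V' 'X_[m]))@_m =
  \sum_(m <- monomials f d) \sum_(m' <- monomials g d')
     (V' 'X_[m])@_m' * (V 'X_[m'])@_m.
  move=> f0 g0 hV'; rewrite !big_seq; apply: eq_bigr => m me.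
  have hm : V' 'X_[m] \is d'.-homog for g.
    by apply: hV'; rewrite dhomogX -mem_monomials.
  rewrite [in LHS](dhomog_expand g0 hm) !linear_sum /=; apply: eq_bigr => m' _.
  by rewrite linearZ /= mcoeffZ.
rewrite (trE _ _ mf mf' e e' T U) // (trE _ _ mf' mf e' e U T) //.
rewrite exchange_big; apply: eq_bigr => i _; apply: eq_bigr => j _.
by rewrite mulrC.
Qed.

End GradedTraceCyclic.

Section Substitution.
Variable R : comNzRingType.

Lemma comp_mpolyA n k l (p : {mpoly R[n]}) (lp : n.-tuple {mpoly R[k]})
    (lq : k.-tuple {mpoly R[l]}) :
  (p \mPo lp) \mPo lq = p \mPo [tuple tnth lp i \mPo lq | i < n].
Proof.
rewrite (comp_mpolyEX p lp) [RHS]comp_mpolyEX raddf_sum /=.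
apply: eq_bigr => m _; rewrite linearZ /= !comp_mpolyX rmorph_prod /=.
congr (_ *: _); apply: eq_bigr => i _.
by rewrite rmorphXn /= tnth_mktuple.
Qed.

Lemma mderiv_comp n k (p : {mpoly R[n]}) (lq : n.-tuple {mpoly R[k]}) j :
  (p \mPo lq)^`M(j) = \sum_i (p^`M(i) \mPo lq) * (tnth lq i)^`M(j).
Proof.
pose D (q : {mpoly R[k]}) := q^`M(j).
have Dprod (I : finType) (F : I -> {mpoly R[k]}) : D (\prod_i F i) =
    \sum_i D (F i) * \prod_(l | l != i) F l.
  suff H (r : seq I) : uniq r -> D (\prod_(i <- r) F i) =
      \sum_(i <- r) D (F i) * \prod_(l <- r | l != i) F l.
    by rewrite H ?index_enum_uniq.
  elim: r => [_|i r IHr /= /andP[ir ur]].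
    by rewrite !big_nil /D -mpolyC1 mderivC.
  rewrite big_cons big_cons /D mderivM -/(D _) -/(D _) IHr //.
  congr (_ + _).
    rewrite big_cons eqxx /=; congr (_ * _).
    rewrite big_seq [RHS]big_seq_cond; apply: eq_bigl => l.
    by case lr: (l \in r) => //=; apply/esym; apply: contraNneq ir => <-.
  rewrite big_distrr /= !big_seq; apply: eq_bigr => l lr.
  rewrite big_cons ifT; last by apply: contraNneq ir => ->.
  by rewrite mulrCA.
have DX (q : {mpoly R[k]}) a : D (q ^+ a) = (q ^+ a.-1 * D q) *+ a.
  elim: a => [|a IHa]; first by rewrite expr0 /D -mpolyC1 mderivC mulr0n.
  rewrite exprS /D mderivM -/(D _) -/(D _) IHa /= mulrnAr mulrS mulrC.
  case: a {IHa} => [|a]; first by rewrite !mulr0n.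
  by rewrite /= mulrA -exprS.
elim/mpolyind: p => [|c m p _ _ IHp].
  rewrite linear0 linear0 big1 // => i _.
  by rewrite linear0 linear0 mul0r.
rewrite linearP /= linearP /= IHp.
transitivity (\sum_i (c *: ((('X_[m])^`M(i) \mPo lq) * (tnth lq i)^`M(j)) +
    (p^`M(i) \mPo lq) * (tnth lq i)^`M(j))).
  rewrite big_split /= -scaler_sumr; congr (_ *: _ + _).
  rewrite comp_mpolyX -/(D _) Dprod; apply: eq_bigr => i _.
  rewrite DX mderivX linearZ /= comp_mpolyX -/(D _).
  rewrite [in RHS](bigD1 i) //= mnmBE mnm1E eqxx subn1.
  rewrite -scaler_nat -!scalerAl; congr (_ *: _).
  rewrite mulrAC; congr (_ * _ * _); apply: eq_bigr => l ne.
  by rewrite mnmBE mnm1E eq_sym (negPf ne) subn0.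
apply: eq_bigr => i _; rewrite linearP /= linearP /=.
by rewrite mulrDl scalerAl.
Qed.

Definition linsubst n (A : 'M[R]_n) (p : {mpoly R[n]}) : {mpoly R[n]} :=
  p \mPo [tuple \sum_j A i j *: 'X_j | i < n].

HB.instance Definition _ n (A : 'M[R]_n) :=
  GRing.LRMorphism.copy (linsubst A) (comp_mpoly [tuple \sum_j A i j *: 'X_j | i < n]).

Lemma linsubstX1 n (A : 'M[R]_n) i : linsubst A 'X_i = \sum_j A i j *: 'X_j.
Proof. by rewrite /linsubst comp_mpolyXU -tnth_nth tnth_mktuple. Qed.

Lemma linsubstM n (A B : 'M[R]_n) p :
  linsubst B (linsubst A p) = linsubst (A *m B) p.
Proof.
rewrite /linsubst comp_mpolyA; congr (p \mPo _); apply: eq_from_tnth => i.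
rewrite !tnth_mktuple linear_sum /=.
under eq_bigr => j _ do
  rewrite linearZ /= comp_mpolyXU -tnth_nth tnth_mktuple scaler_sumr.
rewrite exchange_big; apply: eq_bigr => k _ /=.
under eq_bigr => j _ do rewrite scalerA.
by rewrite -scaler_suml mxE.
Qed.

Lemma linsubst1 n (p : {mpoly R[n]}) : linsubst 1%:M p = p.
Proof.
rewrite -[RHS]comp_mpoly_id; congr (p \mPo _); apply: eq_from_tnth => i.
rewrite !tnth_mktuple (bigD1 i) //= mxE eqxx scale1r big1 ?addr0 // => j ne.
by rewrite mxE eq_sym (negPf ne) scale0r.
Qed.

Lemma dhomog_comp n k (mf : measure n) (mf' : measure k) e (p : {mpoly R[n]})
    (lq : n.-tuple {mpoly R[k]}) :
  (forall i, tnth lq i \is (mf U_(i)%MM).-homog for mf') ->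
  p \is e.-homog for mf -> p \mPo lq \is e.-homog for mf'.
Proof.
move=> hq /dhomogP hp; rewrite comp_mpolyEX big_seq rpred_sum // => m /hp mfm.
apply/rpredZ; rewrite comp_mpolyX -mfm mfE.
have := @dhomog_prod _ _ mf' _ [tuple (m i * mf U_(i)%MM)%N | i < n]
  [tuple tnth lq i ^+ m i | i < n].
rewrite !big_tuple (eq_bigr (fun i => tnth lq i ^+ m i)) => [|i _]; last first.
  by rewrite tnth_mktuple.
rewrite (eq_bigr (fun i => m i * mf U_(i)%MM)%N) => [|i _]; last first.
  by rewrite tnth_mktuple.
by apply=> i; rewrite !tnth_mktuple mulnC; apply: dhomogMn.
Qed.

Lemma linsubst_homog n (A : 'M[R]_n) e p :
  p \is e.-homog -> linsubst A p \is e.-homog.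
Proof.
apply: dhomog_comp => i; rewrite tnth_mktuple /= mdeg1 rpred_sum // => j _.
by apply/rpredZ; rewrite dhomogX /= mdeg1.
Qed.

Lemma mderiv_linsubst n (A : 'M[R]_n) p j :
  (linsubst A p)^`M(j) = \sum_i linsubst A p^`M(i) * (A i j)%:MP.
Proof.
rewrite mderiv_comp; apply: eq_bigr => i _; congr (_ * _).
rewrite tnth_mktuple linear_sum /= (bigD1 j) //= linearZ /= mderivX mnm1E eqxx.
rewrite scale1r big1 ?addr0 => [|k ne].
  have -> : (U_(j) - U_(j) = 0 :> 'X_{1..n})%MM.
    by apply/mnmP => l; rewrite mnmBE subnn mnm0E.
  by rewrite mpolyX0 alg_mpolyC.
by rewrite linearZ /= mderivX mnm1E (negPf ne) scale0r scaler0.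
Qed.

End Substitution.

(** * Molien series *)

Section TruncatedSeries.
Variable K : comNzRingType.
Implicit Types p q : {poly K}.

(** Congruence modulo ['X^E], the only way in which power series are compared. *)
Definition eqmodX E p q := forall e, (e < E)%N -> p`_e = q`_e.

Lemma eqmodX_refl E p : eqmodX E p p. Proof. by []. Qed.

Lemma eqmodX_sym E p q : eqmodX E p q -> eqmodX E q p.
Proof. by move=> pq e /pq. Qed.

Lemma eqmodX_trans E p q r : eqmodX E p q -> eqmodX E q r -> eqmodX E p r.
Proof. by move=> pq qr e eE; rewrite pq // qr. Qed.

Lemma eqmodXM E p p' q q' :
  eqmodX E p p' -> eqmodX E q q' -> eqmodX E (p * q) (p' * q').
Proof.
move=> pp' qq' e eE; rewrite !coefM; apply: eq_bigr => i _.
rewrite pp' ?qq' //; first exact: leq_ltn_trans (leq_subr _ _) eE.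
by apply: leq_ltn_trans eE; rewrite -ltnS.
Qed.

Lemma eqmodX_sum E I (r : seq I) (P : pred I) (F G : I -> {poly K}) :
  (forall i, P i -> eqmodX E (F i) (G i)) ->
  eqmodX E (\sum_(i <- r | P i) F i) (\sum_(i <- r | P i) G i).
Proof. by move=> FG e eE; rewrite !coef_sum; apply: eq_bigr => i /FG ->. Qed.

Lemma eqmodX_prod E I (r : seq I) (P : pred I) (F G : I -> {poly K}) :
  (forall i, P i -> eqmodX E (F i) (G i)) ->
  eqmodX E (\prod_(i <- r | P i) F i) (\prod_(i <- r | P i) G i).
Proof.
move=> FG; elim/big_rec2: _ => [|i p q /FG]; first exact: eqmodX_refl.
by move=> h1 h2; apply: eqmodXM.
Qed.

Lemma eqmodX_eq p q : (forall E, eqmodX E p q) -> p = q.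
Proof. by move=> pq; apply/polyP => e; apply: (pq e.+1). Qed.

Definition trunc E (h : nat -> K) : {poly K} := \poly_(e < E) h e.

(** Multiply out the geometric series of the factors; as the weights are positive, the powers from
    the [E]-th on do not affect the coefficients below [E]. *)
Lemma monomial_series n (mf : measure n) (z : 'I_n -> K) E : positive mf ->
  eqmodX E ((\prod_i (1 - z i *: 'X^(mf U_(i)%MM))) *
    trunc E (fun e => \sum_(m <- monomials mf e) \prod_i z i ^+ m i)) 1.
Proof.
move=> mf0; pose y i : {poly K} := z i *: 'X^(mf U_(i)%MM).
pose S := \prod_i (\sum_(k < E) y i ^+ k).
suff SE : eqmodX E S
    (trunc E (fun e => \sum_(m <- monomials mf e) \prod_i z i ^+ m i)).
  apply: eqmodX_trans (eqmodXM (eqmodX_refl _) (eqmodX_sym SE)) _.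
  rewrite -big_split /=.
  suff : eqmodX E (\prod_i ((1 - y i) * \sum_(k < E) y i ^+ k)) (\prod_(i < n) 1).
    by rewrite big1_eq.
  apply: eqmodX_prod => i _ e eE.
  rewrite -[1 - _]opprB mulNr -subrX1 opprB coefB exprZn -exprM coefZ coefXn.
  by rewrite ltn_eqF ?mulr0 ?subr0 // (leq_trans eE) // leq_pmull.
move=> e eE; rewrite coef_poly eE /S bigA_distr_bigA /= coef_sum.
pose M (b : {ffun 'I_n -> 'I_E}) : 'X_{1..n} := [multinom (b i : nat) | i < n].
have MS (b : {ffun 'I_n -> 'I_E}) :
    \prod_i y i ^+ b i = (\prod_i z i ^+ M b i) *: 'X^(mf (M b)).
  transitivity (\prod_i (z i ^+ M b i *: 'X^(M b i * mf U_(i)%MM))).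
    by apply: eq_bigr => i _; rewrite exprZn -exprM mnmE mulnC.
  rewrite scaler_prod; congr (_ *: _); rewrite mfE.
  by elim/big_rec2: _ => [|i k p _ ->]; rewrite ?expr0 // exprD.
have -> : \sum_(m <- monomials mf e) \prod_i z i ^+ m i =
    \sum_(m <- [seq M b | b <- enum [pred b : {ffun 'I_n -> 'I_E} |
      mf (M b) == e]]) \prod_i z i ^+ m i.
  apply: perm_big; apply: uniq_perm; first exact: monomials_uniq.
    rewrite map_inj_uniq ?enum_uniq // => b b' /mnmP Mb.
    by apply/ffunP => i; apply: val_inj; have := Mb i; rewrite !mnmE.
  move=> m; rewrite mem_monomials //; apply/idP/mapP => [/eqP me | [b]]; last first.
    by rewrite mem_enum => mb ->.
  have mE i : (m i < E)%N.
    apply: leq_ltn_trans eE; rewrite -me mfE (bigD1 i) //=.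
    by apply: leq_trans (leq_addr _ _); rewrite leq_pmulr.
  have mM : m = M [ffun i => Ordinal (mE i)] by apply/mnmP => i; rewrite mnmE ffunE.
  by exists [ffun i => Ordinal (mE i)] => //; rewrite mem_enum inE -mM me.
rewrite big_map big_enum_cond /= [RHS]big_mkcond; apply: eq_bigr => b _.
rewrite MS coefZ coefXn eq_sym inE andbT.
by case: eqP => _; rewrite ?mulr1 ?mulr0.
Qed.

End TruncatedSeries.

(** * The denominators det(1 - t A) *)

Section ReverseCharPoly.
Variable K : comNzRingType.

Definition revchar n (A : 'M[K]_n) : {poly K} :=
  \det (1%:M - 'X *: map_mx polyC A).

Lemma revchar_horner n (A : 'M[K]_n) t : (revchar A).[t] = \det (1%:M - t *: A).
Proof.
rewrite -horner_evalE -det_map_mx; congr (\det _); apply/matrixP => i j.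
by rewrite !mxE rmorphB rmorphM rmorph_nat /= /horner_eval hornerX hornerC.
Qed.

Lemma revchar_diag n (d : 'rV[K]_n) :
  revchar (diag_mx d) = \prod_i (1 - d 0 i *: 'X).
Proof.
have -> : revchar (diag_mx d) = \det (diag_mx (\row_i (1 - d 0 i *: 'X))).
  congr (\det _); apply/matrixP => i j; rewrite !mxE.
  case: eqP => _; last by rewrite !mulr0n polyC0 mulr0 subr0.
  by rewrite !mulr1n mulrC -mul_polyC.
by rewrite det_diag; apply: eq_bigr => i _; rewrite mxE.
Qed.

End ReverseCharPoly.

Lemma revchar_conj (K : comUnitRingType) n (P A : 'M[K]_n) :
  P \in unitmx -> revchar (invmx P *m A *m P) = revchar A.
Proof.
move=> Pu; set Q := map_mx polyC (invmx P); set P' := map_mx polyC P.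
have QP : Q *m P' = 1%:M by rewrite -map_mxM mulVmx // map_mx1.
have -> : revchar (invmx P *m A *m P) =
    \det (Q *m (1%:M - 'X *: map_mx polyC A) *m P').
  congr (\det _); rewrite mulmxBr mulmx1 mulmxBl QP -scalemxAr -scalemxAl.
  by rewrite !map_mxM.
by rewrite !det_mulmx mulrAC -det_mulmx QP det1 mul1r.
Qed.

Lemma char_poly_conj (K : comUnitRingType) n (P A : 'M[K]_n) :
  P \in unitmx -> char_poly (invmx P *m A *m P) = char_poly A.
Proof.
move=> Pu; set Q := map_mx polyC (invmx P); set P' := map_mx polyC P.
have QP : Q *m P' = 1%:M by rewrite -map_mxM mulVmx // map_mx1.
have -> : char_poly (invmx P *m A *m P) = \det (Q *m char_poly_mx A *m P').
  congr (\det _); rewrite mulmxBr mul_mx_scalar mulmxBl -scalemxAl QP scalemx1.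
  by rewrite /char_poly_mx !map_mxM.
by rewrite !det_mulmx mulrAC -det_mulmx QP det1 mul1r.
Qed.

Lemma revchar_map (K L : comNzRingType) (f : {rmorphism K -> L}) n (A : 'M[K]_n) :
  revchar (map_mx f A) = map_poly f (revchar A).
Proof.
rewrite /revchar -det_map_mx; congr (\det _); apply/matrixP => i j.
by rewrite !mxE rmorphB rmorphM /= map_polyX map_polyC /= rmorph_nat.
Qed.

Lemma gtrace_linsubst_map (K L : fieldType) (f : {rmorphism K -> L}) n
    (A : 'M[K]_n) e :
  gtrace mdeg e (linsubst (map_mx f A)) = f (gtrace mdeg e (linsubst A)).
Proof.
rewrite /gtrace rmorph_sum /=; apply: eq_bigr => m _.
rewrite -mcoeff_map_mpoly map_mpoly_comp; last exact: fmorph_inj.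
rewrite map_mpolyX; congr (_ \mPo _)@__; apply: eq_from_tnth => i.
rewrite tnth_map !tnth_mktuple rmorph_sum; apply: eq_bigr => j _ /=.
by rewrite map_mpolyZ map_mpolyX mxE.
Qed.

Lemma gtrace_linsubst_diag (K : comNzRingType) n (d : 'rV[K]_n) e :
  gtrace mdeg e (linsubst (diag_mx d)) =
  \sum_(m <- monomials mdeg e) \prod_i d 0 i ^+ m i.
Proof.
apply: eq_bigr => m _; rewrite /linsubst comp_mpolyX.
have -> : \prod_(i < n) tnth [tuple \sum_j diag_mx d i j *: 'X_j | i < n] i ^+ m i
    = (\prod_i d 0 i ^+ m i) *: 'X_[m] :> {mpoly K[n]}.
  rewrite mpolyXE_id -scaler_prod; apply: eq_bigr => i _.
  rewrite tnth_mktuple (bigD1 i) //= big1 ?addr0 => [|j ne].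
    by rewrite mxE eqxx mulr1n exprZn.
  by rewrite mxE eq_sym (negPf ne) mulr0n scale0r.
by rewrite mcoeffZ mcoeffX eqxx mulr1.
Qed.

Lemma gtrace_linsubst_conj (K : comUnitRingType) n (P A : 'M[K]_n) e :
  P \in unitmx ->
  gtrace mdeg e (linsubst (invmx P *m A *m P)) = gtrace mdeg e (linsubst A).
Proof.
move=> Pu.
transitivity (gtrace mdeg e
    (fun p => linsubst P (linsubst A (linsubst (invmx P) p)))).
  by apply: eq_gtrace => p; rewrite !linsubstM mulmxA.
rewrite (@gtrace_cyclic _ _ _ mdeg mdeg e e (linsubst P)
   (linsubst A \o linsubst (invmx P))); try exact: mdeg_positive.
- by apply: eq_gtrace => p; rewrite /= !linsubstM mulmxA mulmxV // mul1mx.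
- by move=> p hp /=; do 2! apply: linsubst_homog.
by move=> p hp; apply: linsubst_homog.
Qed.

Lemma mxrank_diag (F : fieldType) n (d : 'rV[F]_n) :
  \rank (diag_mx d) = #|[set i | d 0 i != 0]|.
Proof.
set S := [set i | _].
pose B : 'M[F]_(#|S|, n) := \matrix_(k, j) (enum_val k == j)%:R.
have rB : \rank B = #|S|.
  apply/eqP; apply/row_freeP; exists B^T; apply/matrixP => k l.
  rewrite !mxE (bigD1 (enum_val k)) //= !mxE eqxx mul1r big1 ?addr0.
    by rewrite eq_sym (inj_eq enum_val_inj).
  by move=> j ne; rewrite !mxE eq_sym (negPf ne) mul0r.
rewrite -rB; apply/eqP; rewrite eqn_leq; apply/andP; split.
  apply: mxrankS; apply/submxP.
  exists (\matrix_(i, k) (d 0 i *+ (enum_val k == i))).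
  apply/matrixP => i j; rewrite !mxE.
  have [iS|iS] := boolP (i \in S).
    rewrite (bigD1 (enum_rank_in iS i)) //= !mxE enum_rankK_in // eqxx mulr1n.
    rewrite mulr_natr big1 ?addr0 // => k ne.
    rewrite !mxE; case: eqP => [eki|_]; last by rewrite mul0r.
    by case/eqP: ne; apply: enum_val_inj; rewrite enum_rankK_in.
  have di0 : d 0 i = 0.
    by apply/eqP; apply: contraNT iS => di; rewrite inE.
  by rewrite di0 mul0rn big1 // => k _; rewrite !mxE di0 mul0rn mul0r.
apply: mxrankS; apply/submxP.
exists (\matrix_(k, i) ((d 0 i)^-1 *+ (enum_val k == i))).
apply/matrixP => k j; rewrite !mxE (bigD1 (enum_val k)) //= !mxE eqxx mulr1n.
have := enum_valP k; rewrite inE => dk.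
rewrite big1 ?addr0 => [|i ne]; last by rewrite !mxE eq_sym (negPf ne) mul0r.
by case: eqP => _; rewrite ?mulr1n ?mulr0n ?mulr0 ?mulVf.
Qed.

(** * Spectra of real orthogonal matrices *)

Section OrthogonalMatrix.
Variables (R : rcfType) (n : nat) (A : 'M[R]_n).
Hypothesis orthA : A *m A^T = 1%:M.

Local Notation C := R[i].
Local Notation toC := (real_complex R : {rmorphism R -> C}).

Lemma orthogonal_diagonalizable : exists (P : 'M[C]_n) (d : 'rV[C]_n),
  P \in unitmx /\ map_mx toC A = invmx P *m diag_mx d *m P.
Proof.
have nA : map_mx toC A \is normalmx.
  apply/normalmxP.
  have -> : map_mx Num.conj (map_mx toC A)^T = map_mx toC A^T.
    apply/matrixP => i j; rewrite !mxE; apply: conj_Creal.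
    by apply/complex_realP; eexists.
  by rewrite -!map_mxM /= orthA (mulmx1C orthA).
exists (spectralmx (map_mx toC A)), (spectral_diag (map_mx toC A)).
by split; [exact: spectral_unit | exact/orthomx_spectralP].
Qed.

(** Traces and determinant are invariant under conjugation, so [A] may be diagonalized over [R[i]];
    for a diagonal matrix this is [monomial_series] with all weights 1. *)
Lemma molien_series E :
  eqmodX E (revchar A * trunc E (fun e => gtrace mdeg e (linsubst A))) 1.
Proof.
have [P [d [Pu Ad]]] := orthogonal_diagonalizable.
have trE e : toC (gtrace mdeg e (linsubst A)) =
    \sum_(m <- monomials mdeg e) \prod_i d 0 i ^+ m i.
  by rewrite -gtrace_linsubst_map Ad gtrace_linsubst_conj // gtrace_linsubst_diag.
have := @monomial_series _ n mdeg (d 0) E (@mdeg_positive n).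
under eq_bigr => i _ do rewrite /= mdeg1 expr1.
rewrite -revchar_diag -(revchar_conj _ Pu) -Ad revchar_map => h e eE.
apply: (fmorph_inj toC); rewrite -coef_map rmorphM /=.
have -> : toC (1 : {poly R})`_e = (1 : {poly C})`_e by rewrite -coef_map rmorph1.
rewrite -(h e eE); suff -> : map_poly toC (trunc E (gtrace mdeg ^~ (linsubst A)))
  = trunc E (fun e => \sum_(m <- monomials mdeg e) \prod_i d 0 i ^+ m i) by [].
apply/polyP => k.
by rewrite coef_map !coef_poly; case: ifP => _; [apply: trE | apply: rmorph0].
Qed.

Definition codim_fix (B : 'M[R]_n) := \rank (1%:M - B).

(** One list of eigenvalues has to serve all four formulas. Because [A] is diagonalizable, the rank
    of [1 - A] counts the eigenvalues other than 1 with multiplicity. *)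
Lemma orthogonal_spectrum : exists d : 'rV[C]_n,
  [/\ map_poly toC (revchar A) = \prod_i (1 - d 0 i *: 'X),
      toC (\det A) = \prod_i d 0 i
    & codim_fix A = #|[set i | d 0 i != 1]| /\
      map_poly toC (char_poly A) = \prod_i ('X - (d 0 i)%:P)].
Proof.
have [P [d [Pu Ad]]] := orthogonal_diagonalizable; exists d; split.
- by rewrite -revchar_map Ad revchar_conj // revchar_diag.
- have dP : \det P \is a GRing.unit by rewrite -unitmxE.
  by rewrite -det_map_mx /= Ad !det_mulmx det_inv mulrAC mulVr // mul1r det_diag.
rewrite /codim_fix -(mxrank_map toC) map_mxB map_mx1 /= Ad.
have -> : 1%:M - invmx P *m diag_mx d *m P =
    invmx P *m diag_mx (\row_i (1 - d 0 i)) *m P.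
  have -> : diag_mx (\row_i (1 - d 0 i)) = 1%:M - diag_mx d.
    by apply/matrixP => i j; rewrite !mxE -mulrnBl.
  by rewrite mulmxBr mulmx1 mulmxBl mulVmx.
rewrite mxrankMfree ?row_free_unit // eqmxMfull ?row_full_unit ?unitmx_inv //.
rewrite mxrank_diag; split.
  by apply: eq_card => i; rewrite !inE mxE subr_eq0 eq_sym.
rewrite map_char_poly /= Ad char_poly_conj // char_poly_trig; last first.
  by apply/is_trig_mxP => i j ij; rewrite mxE -val_eqE ltn_eqF.
by apply: eq_bigr => i _; rewrite mxE eqxx.
Qed.

Lemma codim_fix_le : (codim_fix A <= n)%N.
Proof. exact: rank_leq_row. Qed.

(** The factorization is visible over [R[i]]; divisibility descends to [R], which provides a real
    cofactor. *)
Lemma revchar_factor : exists2 Q : {poly R}, Q.[1] != 0 &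
  revchar A = (1 - 'X) ^+ (n - codim_fix A) * Q.
Proof.
have [d [hA _ [cA _]]] := orthogonal_spectrum.
pose Q' : {poly C} := \prod_(i | d 0 i != 1) (1 - d 0 i *: 'X).
have kE : #|[set i | d 0 i == 1]| = (n - codim_fix A)%N.
  apply/eqP; rewrite -(eqn_add2r (codim_fix A)) subnK ?codim_fix_le // cA.
  have := cardsC [set i | d 0 i == 1]; rewrite card_ord.
  have -> : ~: [set i | d 0 i == 1] = [set i | d 0 i != 1].
    by apply/setP => i; rewrite !inE.
  by move/eqP.
have facC : map_poly toC (revchar A) = (1 - 'X) ^+ (n - codim_fix A) * Q'.
  rewrite hA (bigID (fun i => d 0 i == 1)) /=; congr (_ * _).
  rewrite (eq_bigr (fun=> 1 - 'X)) => [|i /eqP->]; last by rewrite scale1r.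
  by rewrite prodr_const -kE; congr (_ ^+ _); apply: eq_card => i; rewrite inE.
have [Q QE] : exists Q, revchar A = (1 - 'X) ^+ (n - codim_fix A) * Q.
  have : (1 - 'X) ^+ (n - codim_fix A) %| revchar A.
    rewrite -(dvdp_map toC) facC rmorphXn rmorphB rmorph1 /= map_polyX.
    exact: dvdp_mulr.
  by case/dvdpP => Q ->; exists Q; rewrite mulrC.
exists Q => //.
have XC0 : (1 - 'X) ^+ (n - codim_fix A) != 0 :> {poly C}.
  by rewrite expf_neq0 // -opprB oppr_eq0 polyXsubC_eq0.
have mapQ : map_poly toC Q = Q'.
  apply: (mulfI XC0); rewrite -facC QE rmorphM rmorphXn rmorphB rmorph1 /=.
  by rewrite map_polyX.
rewrite -(fmorph_eq0 toC) -horner_map mapQ rmorph1 horner_prod.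
apply/prodf_neq0 => i di; rewrite !hornerE.
by rewrite subr_eq0 eq_sym.
Qed.

(** Multiply ['X - A] by the inverse [A^T] to get ['X *: A^T - 1]; the determinant of [A] is its own
    inverse. *)
Lemma char_poly_recip :
  char_poly A = (\det A)%:P * (-1) ^+ n * revchar A.
Proof.
have detM : \det (map_mx polyC A) = (\det A)%:P by rewrite -det_map_mx.
have AtA : map_mx polyC A^T *m map_mx polyC A = 1%:M.
  by rewrite -map_mxM (mulmx1C orthA) map_mx1.
have det2 : (\det A)%:P * (\det A)%:P = 1 :> {poly R}.
  by rewrite -polyCM -{2}det_tr -det_mulmx orthA det1.
suff : (\det A)%:P * char_poly A = (-1) ^+ n * revchar A.
  by move/(congr1 ( *%R (\det A)%:P)); rewrite mulrA det2 mul1r mulrA.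
rewrite -{1}(det_tr A) -det_map_mx /char_poly /char_poly_mx -det_mulmx mulmxBr.
rewrite AtA mul_mx_scalar -[RHS]detZ -det_tr; congr (\det _).
by apply/matrixP => i j; rewrite !mxE mulN1r opprB eq_sym.
Qed.

(* The eigenvalue 1 contributes a power of X - 1 to the characteristic polynomial
   and of 1 - X to its reciprocal; the other factors agree at X = 1. *)
Lemma det_orthogonal : \det A = (-1) ^+ codim_fix A.
Proof.
have [d [hA dA [cA charC]]] := orthogonal_spectrum.
set k := #|[set i | d 0 i == 1]|.
have kE : (n = k + codim_fix A)%N.
  have := cardsC [set i | d 0 i == 1]; rewrite card_ord cA => {1}<-.
  by congr (_ + _)%N; apply: eq_card => i; rewrite !inE.
have split (F : C -> {poly C}) : \prod_i F (d 0 i) =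
    F 1 ^+ k * \prod_(i | d 0 i != 1) F (d 0 i).
  rewrite (bigID (fun i => d 0 i == 1)) /=; congr (_ * _).
  rewrite (eq_bigr (fun=> F 1)) => [|i /eqP-> //].
  by rewrite prodr_const; congr (_ ^+ _); apply: eq_card => i; rewrite inE.
have /(congr1 (map_poly toC)) := char_poly_recip.
rewrite charC !rmorphM rmorphXn rmorphN1 /= hA map_polyC /=.
rewrite (split (fun c => 'X - c%:P)) (split (fun c => 1 - c *: 'X)) scale1r.
set R1 := \prod_(i | _) ('X - _); set R2 := \prod_(i | _) (1 - _).
rewrite -[1 - 'X]opprB (exprNn ('X - 1)) polyC1.
have -> (a b c x r : {poly C}) : a * b * (c * x * r) = x * (a * b * c * r) by ring.
have X1 : ('X - 1) ^+ k != 0 :> {poly C} by rewrite expf_neq0 // polyXsubC_eq0.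
move/(mulfI X1)/(congr1 (fun p => p.[1])).
have R12 : R2.[1] = R1.[1].
  rewrite !horner_prod; apply: eq_bigr => i _; rewrite !hornerE //.
have R1n0 : R1.[1] != 0.
  rewrite horner_prod; apply/prodf_neq0 => i di; rewrite !hornerE.
  by rewrite subr_eq0 eq_sym.
rewrite !hornerM R12 hornerC !horner_exp !hornerE -[LHS]mul1r.
move/(mulIf R1n0)=> h; apply: (fmorph_inj toC).
have sq (j : nat) : (-1) ^+ j * (-1) ^+ j = 1 :> C by rewrite -expr2 sqrr_sign.
have ag : toC (\det A) * (-1) ^+ codim_fix A = 1.
  have -> : (-1) ^+ codim_fix A = (-1) ^+ n * (-1) ^+ k :> C.
    have -> : (-1) ^+ n = (-1) ^+ k * (-1) ^+ codim_fix A :> C by rewrite -exprD -kE.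
    by rewrite mulrAC -expr2 sqrr_sign mul1r.
  by rewrite [RHS]h mulrA.
have /= := congr1 ( *%R^~ ((-1) ^+ codim_fix A)) ag.
by rewrite -mulrA sq mulr1 mul1r rmorphXn rmorphN1.
Qed.

(** The functional equation under t -> 1/t, from which the number of mirrors will be computed. *)
Lemma revchar_recip t : t != 0 ->
  (revchar A).[t^-1] = \det A * (- t^-1) ^+ n * (revchar A).[t].
Proof.
move=> t0; have := congr1 (fun p => t^-1 ^+ n * p.[t]) char_poly_recip.
have -> : (char_poly A).[t] = \det (t%:M - A).
  rewrite -horner_evalE -det_map_mx; congr (\det _); apply/matrixP => i j.
  by rewrite !mxE rmorphB rmorphMn /= /horner_eval hornerX hornerC.
rewrite -detZ scalerBr scale_scalar_mx mulVf // -revchar_horner => ->.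
rewrite !hornerM hornerC horner_exp hornerN hornerC [in RHS]exprNn !mulrA.
by congr (_ * _); rewrite -mulrA mulrC.
Qed.

(** A vector with [v = t v A] satisfies |v|^2 = t^2 |v|^2. This is the origin of the condition
    [t ^+ 2 != 1] in all later evaluations. *)
Lemma revchar_neq0 t : t ^+ 2 != 1 -> (revchar A).[t] != 0.
Proof.
move=> t1; rewrite revchar_horner; apply/negP => /det0P[v v0].
rewrite mulmxBr mulmx1 -scalemxAr => /eqP; rewrite subr_eq0 => /eqP vE.
have vv : v *m v^T = t ^+ 2 *: (v *m v^T).
  rewrite {1}vE {1}[in X in _ *m X]vE linearZ /= trmx_mul -scalemxAl -scalemxAr.
  by rewrite scalerA mulmxA -(mulmxA v) orthA mulmx1.
have : (1 - t ^+ 2) *: (v *m v^T) = 0 by rewrite scalerBl scale1r -vv subrr.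
move/eqP; rewrite scalemx_eq0 subr_eq0 eq_sym (negPf t1) /= => /eqP/matrixP/(_ 0 0).
rewrite !mxE => s0; case/negP: v0; apply/eqP/rowP => i.
have /eqP : v 0 i * v^T i 0 = 0.
  by apply: (psumr_eq0P _ s0) => // j _; rewrite mxE -expr2 sqr_ge0.
by rewrite !mxE mulf_eq0 orbb => /eqP.
Qed.

End OrthogonalMatrix.

(** * Skew polynomials *)

Section HomogeneousQuotient.
Variables (R : idomainType) (n : nat).
Implicit Types p q : {mpoly R[n]}.

(* The subtraction is truncated, hence the second conjunct. *)
Lemma dhomog_quotient d e p q : p != 0 -> p \is d.-homog ->
  p * q \is e.-homog -> q \is (e - d).-homog /\ ((e < d)%N -> q = 0).
Proof.
move=> p0 pa pqe.
have piM : pihomog mdeg e (p * q) =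
    \sum_(m <- msupp q) if (d + mdeg m == e)%N then q@_m *: (p * 'X_[m]) else 0.
  rewrite [q in LHS]mpolyE mulr_sumr linear_sum /=; apply: eq_bigr => m _.
  rewrite -scalerAr linearZ /=.
  have hm : p * 'X_[m] \is (d + mdeg m).-homog by rewrite dhomogM ?dhomogX.
  case: eqP => [<-|/eqP ne]; first by rewrite pihomog_dE.
  by rewrite (pihomog_ne0 ne) // scaler0.
move: piM; rewrite pihomog_dE //.
have [lt_ea|le_ae] := ltnP e d.
  rewrite big1 => [pq0|m _]; last first.
    by case: eqP => // am; move: lt_ea; rewrite -am ltnNge leq_addr.
  have -> : q = 0.
    by apply/eqP; move/eqP: pq0; rewrite mulf_eq0 (negPf p0).
  by split=> //; apply: dhomog0.
move=> pqE; split=> //.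
suff -> : q = pihomog mdeg (e - d) q by apply: pihomogP.
apply: (mulfI p0); rewrite pqE pihomogE mulr_sumr [RHS]big_mkcond /=.
apply: eq_bigr => m _; rewrite -[in RHS](eqn_add2l d) subnKC // -scalerAr.
by case: ifP.
Qed.

End HomogeneousQuotient.

Section SkewInvariants.
Variables (R : realType) (n : nat) (W : finGroupType).
Variable rho : mx_representation R [set: W] n.
Hypothesis orth : forall w, rho w *m (rho w)^T = 1%:M.
Implicit Types (p q : {mpoly R[n]}) (w u : W).

Definition wsubst w p := linsubst (rho w) p.

HB.instance Definition _ w := GRing.LRMorphism.copy (wsubst w) (linsubst (rho w)).

Lemma wsubstM u w p : wsubst u (wsubst w p) = wsubst (w * u)%g p.
Proof. by rewrite /wsubst linsubstM repr_mxM ?inE. Qed.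

Lemma wsubst1 p : wsubst 1%g p = p.
Proof. by rewrite /wsubst repr_mx1 linsubst1. Qed.

Lemma wsubst_homog w e p : p \is e.-homog -> wsubst w p \is e.-homog.
Proof. exact: linsubst_homog. Qed.

Definition sgn w := \det (rho w).

Lemma sgnM u w : sgn (u * w)%g = sgn u * sgn w.
Proof. by rewrite /sgn repr_mxM ?inE // det_mulmx. Qed.

Lemma sgn1 : sgn 1%g = 1.
Proof. by rewrite /sgn repr_mx1 det1. Qed.

Lemma sgn_sqr w : sgn w * sgn w = 1.
Proof. by rewrite /sgn -{2}det_tr -det_mulmx orth det1. Qed.

Lemma sgnV w : sgn (w^-1)%g = sgn w.
Proof. by rewrite -[LHS]mulr1 -(sgn_sqr w) mulrA -sgnM mulVg sgn1 mul1r. Qed.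

Definition winvariant p := forall w, wsubst w p = p.
Definition wskew p := forall w, wsubst w p = sgn w *: p.

Definition symmetrize p := \sum_w wsubst w p.
Definition antisymmetrize p := \sum_w sgn w *: wsubst w p.

Lemma symmetrize_is_linear : linear symmetrize.
Proof.
move=> a p q; rewrite /symmetrize scaler_sumr -big_split /=.
by apply: eq_bigr => w _; rewrite linearP.
Qed.

HB.instance Definition _ :=
  GRing.isLinear.Build R {mpoly R[n]} {mpoly R[n]} _ symmetrize
    symmetrize_is_linear.

Lemma antisymmetrize_is_linear : linear antisymmetrize.
Proof.
move=> a p q; rewrite /antisymmetrize scaler_sumr -big_split /=.
by apply: eq_bigr => w _; rewrite linearP scalerDr !scalerA mulrC.
Qed.

HB.instance Definition _ :=
  GRing.isLinear.Build R {mpoly R[n]} {mpoly R[n]} _ antisymmetrize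
    antisymmetrize_is_linear.

Lemma symmetrize_invariant p : winvariant (symmetrize p).
Proof.
move=> u; rewrite linear_sum /= /symmetrize (reindex_inj (mulIg u^-1)%g) /=.
by apply: eq_bigr => w _; rewrite wsubstM mulgKV.
Qed.

Lemma antisymmetrize_skew p : wskew (antisymmetrize p).
Proof.
move=> u; rewrite linear_sum /= /antisymmetrize (reindex_inj (mulIg u^-1)%g) /=.
rewrite scaler_sumr; apply: eq_bigr => w _.
by rewrite linearZ /= wsubstM mulgKV sgnM sgnV scalerA mulrC.
Qed.

Lemma symmetrize_inv p : winvariant p -> symmetrize p = #|W|%:R *: p.
Proof.
move=> invp; rewrite /symmetrize (eq_bigr (fun=> p)) => [|w _]; last exact: invp.
by rewrite sumr_const scaler_nat.
Qed.

Lemma antisymmetrize_wskew p : wskew p -> antisymmetrize p = #|W|%:R *: p.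
Proof.
move=> skp; rewrite /antisymmetrize (eq_bigr (fun=> p)) => [|w _].
  by rewrite sumr_const scaler_nat.
by rewrite skp scalerA sgn_sqr scale1r.
Qed.

Lemma antisymmetrizeM p q : winvariant p ->
  antisymmetrize (p * q) = p * antisymmetrize q.
Proof.
move=> invp; rewrite mulr_sumr; apply: eq_bigr => w _.
by rewrite rmorphM /= invp -scalerAr.
Qed.

Lemma symmetrize_homog e p : p \is e.-homog -> symmetrize p \is e.-homog.
Proof. by move=> pe; apply: rpred_sum => w _; apply: wsubst_homog. Qed.

Lemma antisymmetrize_homog e p : p \is e.-homog -> antisymmetrize p \is e.-homog.
Proof.
by move=> pe; apply: rpred_sum => w _; apply: rpredZ; apply: wsubst_homog.
Qed.

Lemma cardW_neq0 : #|W|%:R != 0 :> R.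
Proof. by rewrite pnatr_eq0 -lt0n; apply/card_gt0P; exists 1%g. Qed.

Definition average p := #|W|%:R^-1 *: symmetrize p.

Lemma average_is_linear : linear average.
Proof.
by move=> a p q; rewrite /average linearP scalerDr !scalerA mulrC.
Qed.

HB.instance Definition _ :=
  GRing.isLinear.Build R {mpoly R[n]} {mpoly R[n]} _ average average_is_linear.

Lemma average_invariant p : winvariant (average p).
Proof. by move=> w; rewrite linearZ /= symmetrize_invariant. Qed.

Lemma average_inv p : winvariant p -> average p = p.
Proof.
by move=> invp; rewrite /average symmetrize_inv // scalerA mulVf ?cardW_neq0 ?scale1r.
Qed.

Section SkewGenerator.
Variables (D : {mpoly R[n]}) (M : nat).
Hypothesis D0 : D != 0.
Hypothesis Dskew : wskew D.
Hypothesis Dhomog : D \is M.-homog.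
Hypothesis Dgen : forall p, wskew p -> exists q, p = D * q.

(** [D] is any homogeneous generator of the skew polynomials: it will be [mirror_poly] and, once the
    degrees are known to agree, the Jacobian. The quotients are chosen one by one; cancelling [D]
    makes them linear and invariant. *)
Lemma skew_quotient_subproof :
  {L : {mpoly R[n]} -> {mpoly R[n]} | forall p, antisymmetrize p = D * L p}.
Proof.
have ex p : exists q, antisymmetrize p == D * q.
  by have [q ->] := Dgen (antisymmetrize_skew p); exists q.
by exists (fun p => xchoose (ex p)) => p; apply/eqP/(xchooseP (ex p)).
Qed.

Definition skew_quotient := sval skew_quotient_subproof.

Lemma skew_quotientE p : antisymmetrize p = D * skew_quotient p.
Proof. exact: (svalP skew_quotient_subproof). Qed.

Lemma skew_quotient_is_linear : linear skew_quotient.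
Proof.
move=> a p q; apply: (mulfI D0).
rewrite -(skew_quotientE (a *: p + q)) mulrDr -scalerAr -(skew_quotientE p).
by rewrite -(skew_quotientE q) linearP.
Qed.

HB.instance Definition _ :=
  GRing.isLinear.Build R {mpoly R[n]} {mpoly R[n]} _ skew_quotient
    skew_quotient_is_linear.

Lemma skew_quotient_invariant p : winvariant (skew_quotient p).
Proof.
move=> w; apply: (mulfI D0).
have := antisymmetrize_skew p w; rewrite (skew_quotientE p) rmorphM /= Dskew.
rewrite -scalerAl => /(congr1 ( *:%R (sgn w))).
by rewrite !scalerA sgn_sqr !scale1r.
Qed.

Lemma skew_quotientM p q : winvariant p ->
  skew_quotient (p * q) = p * skew_quotient q.
Proof.
move=> invp; apply: (mulfI D0).
by rewrite -(skew_quotientE (p * q)) antisymmetrizeM // (skew_quotientE q) mulrCA.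
Qed.

Lemma skew_quotient_gen : skew_quotient D = #|W|%:R%:MP.
Proof.
apply: (mulfI D0).
by rewrite -(skew_quotientE D) antisymmetrize_wskew // mulrC mul_mpolyC.
Qed.

Lemma skew_quotient_homog e p : p \is e.-homog ->
  skew_quotient p \is (e - M).-homog /\ ((e < M)%N -> skew_quotient p = 0).
Proof.
move=> pe; apply: (dhomog_quotient D0 Dhomog).
by rewrite -(skew_quotientE p) antisymmetrize_homog.
Qed.

(* Cyclicity turns p |-> c L(d p) into p |-> L(d c p), and on invariants these
   add up to the multiplication by L(D) = |W|. *)
Lemma gtrace_skew_quotient (I : finType) (c d : I -> {mpoly R[n]}) k l e :
  (k + l = M)%N -> (forall i, c i \is k.-homog) -> (forall i, d i \is l.-homog) ->
  \sum_i c i * d i = D ->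
  \sum_i gtrace mdeg e (fun p => c i * skew_quotient (d i * p)) =
  if (k <= e)%N then gtrace mdeg (e - k) symmetrize else 0.
Proof.
move=> abM ca db cdD.
have Ldeg i p : p \is e.-homog -> skew_quotient (d i * p) \is (e - k).-homog /\
    ((e < k)%N -> skew_quotient (d i * p) = 0).
  move=> pe; have [h1 h2] := skew_quotient_homog (dhomogM (db i) pe).
  have eE : (l + e - M = e - k)%N by rewrite -abM [(k + l)%N]addnC subnDl.
  split; first by rewrite -eE.
  by move=> ea; apply: h2; rewrite -abM addnC ltn_add2r.
case: leqP => [ae|ea]; last first.
  rewrite big1 // => i _; rewrite /gtrace big1_seq // => m /= me.
  rewrite (Ldeg i _ _).2 ?mulr0 ?mcoeff0 //.
  by rewrite dhomogX -mem_monomials //; apply: mdeg_positive.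
have mulD (r : {mpoly R[n]}) : linear (fun p => r * p).
  by move=> x p q; rewrite mulrDr scalerAr.
(* [average] changes nothing on the image of [skew_quotient], which is invariant; after the cyclic
   exchange it makes the operand invariant, so that it can be taken out of [skew_quotient]. *)
pose cmul i := HB.pack_for {linear {mpoly R[n]} -> {mpoly R[n]}}
  (fun p => c i * average p)
  (GRing.isLinear.Build R {mpoly R[n]} {mpoly R[n]} _
     (fun p => c i * average p)
     (fun x p q => etrans (congr1 _ (linearP average x p q)) (mulD (c i) x _ _))).
pose Lmul i := HB.pack_for {linear {mpoly R[n]} -> {mpoly R[n]}}
  (fun p => skew_quotient (d i * p))
  (GRing.isLinear.Build R {mpoly R[n]} {mpoly R[n]} _
     (fun p => skew_quotient (d i * p))
     (fun x p q => etrans (congr1 _ (mulD (d i) x p q))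
        (linearP skew_quotient x _ _))).
transitivity (\sum_i gtrace mdeg (e - k) (fun p => Lmul i (cmul i p))).
  apply: eq_bigr => i _.
  rewrite -(@gtrace_cyclic _ _ _ mdeg mdeg e (e - k) (cmul i) (Lmul i));
    try exact: mdeg_positive.
  - apply: eq_gtrace => p /=; rewrite average_inv //.
    exact: skew_quotient_invariant.
  - by move=> p /(Ldeg i)[].
  move=> p pe /=; rewrite -(subnKC ae); apply: dhomogM (ca i) _.
  by apply: rpredZ; apply: symmetrize_homog.
rewrite -gtrace_sum; apply: eq_gtrace => p /=.
transitivity (average p * skew_quotient (\sum_i c i * d i)).
  rewrite linear_sum mulr_sumr; apply: eq_bigr => i _ /=.
  rewrite -skew_quotientM; last exact: average_invariant.
  by congr skew_quotient; rewrite mulrCA mulrA mulrC.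
rewrite cdD skew_quotient_gen mulrC mul_mpolyC scalerA mulfV ?scale1r //.
exact: cardW_neq0.
Qed.

End SkewGenerator.

End SkewInvariants.

(** * Reflections and mirrors *)

Section LinearForms.
Variables (R : realType) (n : nat).
Implicit Types (a b v : 'cV[R]_n) (p q : {mpoly R[n]}).

Lemma dotE a b : a^T *m b = (dot a b)%:M.
Proof.
apply/matrixP => i j; rewrite !ord1 !mxE eqxx mulr1n.
by apply: eq_bigr => k _; rewrite mxE.
Qed.

Lemma dotC a b : dot a b = dot b a.
Proof. by apply: eq_bigr => i _; rewrite mulrC. Qed.

Lemma dotDl a b v : dot (a + b) v = dot a v + dot b v.
Proof. by rewrite -big_split; apply: eq_bigr => i _; rewrite mxE mulrDl. Qed.

Lemma dotZl k a v : dot (k *: a) v = k * dot a v.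
Proof. by rewrite mulr_sumr; apply: eq_bigr => i _; rewrite mxE mulrA. Qed.

Lemma dotZr k a v : dot v (k *: a) = k * dot v a.
Proof. by rewrite dotC dotZl (dotC v). Qed.

Lemma dotNl a v : dot (- a) v = - dot a v.
Proof. by rewrite -scaleN1r dotZl mulN1r. Qed.

Lemma dot_suml I (r : seq I) (P : pred I) (F : I -> 'cV[R]_n) v :
  dot (\sum_(i <- r | P i) F i) v = \sum_(i <- r | P i) dot (F i) v.
Proof.
elim/big_rec2: _ => [|i x y _ <-]; last by rewrite dotDl.
by rewrite /dot big1 // => i _; rewrite mxE mul0r.
Qed.

Lemma dot_mulmx (A : 'M[R]_n) a b : dot (A *m a) b = dot a (A^T *m b).
Proof.
suff : (dot (A *m a) b)%:M = (dot a (A^T *m b))%:M :> 'M[R]_1.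
  by move/matrixP/(_ 0 0); rewrite !mxE eqxx !mulr1n.
by rewrite -!dotE trmx_mul mulmxA.
Qed.

Lemma dot_eq0 a : (dot a a == 0) = (a == 0).
Proof.
apply/eqP/eqP => [aa|->]; last by rewrite /dot big1 // => i _; rewrite mxE mul0r.
apply/matrixP => i j; rewrite ord1 [RHS]mxE.
have /eqP : a i 0 * a i 0 = 0.
  by apply: (psumr_eq0P _ aa) => // k _; rewrite -expr2 sqr_ge0.
by rewrite mulf_eq0 orbb => /eqP.
Qed.

Lemma dot_ge0 a : 0 <= dot a a.
Proof. by apply: sumr_ge0 => i _; rewrite -expr2 sqr_ge0. Qed.

Lemma dot_gt0 a : a != 0 -> 0 < dot a a.
Proof. by move=> a0; rewrite lt_neqAle dot_ge0 eq_sym dot_eq0 a0. Qed.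

Definition reflmx a : 'M[R]_n := 1%:M - (2 / dot a a) *: (a *m a^T).
Definition projmx a : 'M[R]_n := 1%:M - (dot a a)^-1 *: (a *m a^T).

Lemma reflmxE a v : reflmx a *m v = reflection a v.
Proof.
rewrite mulmxBl mul1mx -scalemxAl -mulmxA dotE mul_mx_scalar scalerA.
by rewrite /reflection dotC mulrAC.
Qed.

Lemma reflmx_tr a : (reflmx a)^T = reflmx a.
Proof. by rewrite linearB linearZ /= trmx_mul trmxK trmx1. Qed.

Lemma projmx_tr a : (projmx a)^T = projmx a.
Proof. by rewrite linearB linearZ /= trmx_mul trmxK trmx1. Qed.

Lemma projmxE a v : projmx a *m v = v - (dot v a / dot a a) *: a.
Proof.
rewrite mulmxBl mul1mx -scalemxAl -mulmxA dotE mul_mx_scalar scalerA.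
by rewrite dotC mulrC.
Qed.

Lemma projmx_id a : a != 0 -> projmx a *m a = 0.
Proof. by move=> a0; rewrite projmxE divff ?dot_eq0 // scale1r subrr. Qed.

Lemma reflmx_id a : a != 0 -> reflmx a *m a = - a.
Proof.
move=> a0; rewrite reflmxE /reflection -mulrA divff ?dot_eq0 // mulr1.
by rewrite scaler_nat mulr2n opprD addrA subrr add0r.
Qed.

Lemma reflmx_proj a : a != 0 -> reflmx a *m projmx a = projmx a.
Proof.
move=> a0; rewrite {1}/reflmx mulmxBl mul1mx -scalemxAl -mulmxA.
have -> : a^T *m projmx a = 0.
  by rewrite -[LHS]trmxK trmx_mul trmxK projmx_tr projmx_id ?trmx0.
by rewrite mulmx0 scaler0 subr0.
Qed.

Lemma reflmx_sqr a : a != 0 -> reflmx a *m reflmx a = 1%:M.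
Proof.
move=> a0; rewrite {2}/reflmx mulmxBr mulmx1 -scalemxAr mulmxA reflmx_id //.
rewrite mulNmx scalerN opprK /reflmx.
by rewrite subrK.
Qed.

Lemma reflmxZ k a : k != 0 -> reflmx (k *: a) = reflmx a.
Proof.
move=> k0; rewrite /reflmx dotZl dotZr.
have -> : (k *: a) *m (k *: a)^T = (k * k) *: (a *m a^T).
  by apply/matrixP => i j; rewrite !mxE !big_ord_recl !big_ord0 !mxE; ring.
rewrite scalerA; have [->|a0] := eqVneq a 0; first by rewrite mul0mx !scaler0.
congr (_ - _ *: _); rewrite !invfM; have : dot a a != 0 by rewrite dot_eq0.
by move=> d0; field; rewrite d0.
Qed.

Lemma reflmx_conj (A : 'M[R]_n) a : A *m A^T = 1%:M ->
  reflmx (A *m a) = A *m reflmx a *m A^T.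
Proof.
move=> AA; have AtA := mulmx1C AA.
rewrite /reflmx mulmxBr mulmx1 mulmxBl AA -scalemxAr -scalemxAl.
by rewrite dot_mulmx mulmxA AtA mul1mx trmx_mul !mulmxA.
Qed.

Lemma codim_reflmx a : a != 0 -> codim_fix (reflmx a) = 1%N.
Proof.
move=> a0; rewrite /codim_fix /reflmx opprB addrCA subrr addr0.
have d0 : dot a a != 0 by rewrite dot_eq0.
apply/eqP; rewrite eqn_leq; apply/andP; split.
  apply: leq_trans (mxrank_scale _ _) _; apply: leq_trans (mxrankM_maxr _ _) _.
  exact: rank_leq_row.
rewrite lt0n mxrank_eq0 scalemx_eq0 mulf_eq0 pnatr_eq0 invr_eq0 (negPf d0) /=.
apply/eqP => /(congr1 (mulmx^~ a)); rewrite mul0mx -mulmxA dotE mul_mx_scalar.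
by move/eqP; rewrite scalemx_eq0 (negPf d0) (negPf a0).
Qed.

Lemma det_reflmx a : a != 0 -> \det (reflmx a) = -1.
Proof.
by move=> a0; rewrite det_orthogonal ?codim_reflmx // reflmx_tr reflmx_sqr.
Qed.

Definition lform a : {mpoly R[n]} := \sum_i a i 0 *: 'X_i.

Lemma lform_eq0 a : (lform a == 0) = (a == 0).
Proof.
apply/eqP/eqP => [a0|->].
  apply/matrixP => i j; rewrite ord1 mxE.
  have := congr1 (mcoeff U_(i)) a0; rewrite mcoeff0 => <-.
  rewrite /lform linear_sum /= (bigD1 i) //= mcoeffZ mcoeffXU eqxx mulr1.
  by rewrite big1 ?addr0 // => k ne; rewrite mcoeffZ mcoeffXU (negPf ne) mulr0.
by rewrite /lform big1 // => i _; rewrite mxE scale0r.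
Qed.

Lemma lformZ k a : lform (k *: a) = k *: lform a.
Proof. by rewrite scaler_sumr; apply: eq_bigr => i _; rewrite mxE scalerA. Qed.

Lemma lform_homog a : lform a \is 1.-homog.
Proof.
by apply: rpred_sum => i _; apply: rpredZ; rewrite dhomogX /= mdeg1.
Qed.

Lemma linsubst_lform (A : 'M[R]_n) a : linsubst A (lform a) = lform (A^T *m a).
Proof.
rewrite linear_sum /=.
under eq_bigr => i _ do rewrite linearZ /= linsubstX1 scaler_sumr.
rewrite exchange_big; apply: eq_bigr => j _ /=.
rewrite mxE scaler_suml; apply: eq_bigr => i _.
by rewrite scalerA mxE mulrC.
Qed.

(** Modulo [lform a] the substitution fixes every variable, hence every polynomial. *)
Lemma linsubst_projmx a p : exists q, p = linsubst (projmx a) p + lform a * q.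
Proof.
pose S p := exists q, p = linsubst (projmx a) p + lform a * q.
have S1 : S 1 by exists 0; rewrite rmorph1 mulr0 addr0.
have SM p1 p2 : S p1 -> S p2 -> S (p1 * p2).
  move=> [q1 e1] [q2 e2]; rewrite /S rmorphM /=.
  exists (q1 * p2 + linsubst (projmx a) p1 * q2).
  rewrite {1}e1 mulrDl; set P1 := linsubst _ p1.
  have -> : P1 * p2 = P1 * (linsubst (projmx a) p2 + lform a * q2) by rewrite -e2.
  by ring.
have SX i : S 'X_i.
  exists (((dot a a)^-1 * a i 0)%:MP); rewrite linsubstX1.
  have -> : \sum_j projmx a i j *: 'X_j =
     \sum_j ((1%:M i j) *: 'X_j - ((dot a a)^-1 * a i 0) *: (a j 0 *: 'X_j))
     :> {mpoly R[n]}.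
    apply: eq_bigr => j _; rewrite scalerA -scalerBl; congr (_ *: _).
    by rewrite !mxE big_ord_recl big_ord0 !mxE addr0 mulrA.
  rewrite sumrB -scaler_sumr -/(lform a) [lform a * _]mulrC mul_mpolyC subrK.
  rewrite (bigD1 i) //= mxE eqxx scale1r big1 ?addr0 // => j ne.
  by rewrite mxE eq_sym (negPf ne) scale0r.
have SXn i k : S ('X_i ^+ k).
  by elim: k => [|k IHk]; rewrite ?expr0 // exprS; apply: SM.
change (S p); elim/mpolyind: p => [|c m p _ _ [q ep]].
  by exists 0; rewrite linear0 mulr0 addr0.
have [q' em] : S 'X_[m].
  by rewrite mpolyXE_id; elim/big_ind: _.
exists (c *: q' + q); rewrite linearP /= {1}ep {1}em mulrDr scalerDr -scalerAr.
by rewrite addrACA.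
Qed.

(* Substituting projmx a restricts p to the hyperplane orthogonal to a. *)
Lemma lform_dvd a p : linsubst (projmx a) p = 0 -> exists q, p = lform a * q.
Proof.
by have [q pE] := linsubst_projmx a p => P0; exists q; rewrite {1}pE P0 add0r.
Qed.

(** The reflection fixes its mirror pointwise, so on the mirror [p] equals [- p]. *)
Lemma skew_proj0 a p : a != 0 -> linsubst (reflmx a) p = - p ->
  linsubst (projmx a) p = 0.
Proof.
move=> a0 sp; have := congr1 (linsubst (projmx a)) sp.
rewrite linsubstM reflmx_proj // linearN /= => /eqP.
rewrite -addr_eq0 -mulr2n -scaler_nat scaler_eq0 pnatr_eq0 /=.
by move/eqP.
Qed.

End LinearForms.

Section ReflectionGroup.
Variables (R : realType) (n : nat) (W : finGroupType) (s : 'I_n -> W).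
Variable rho : mx_representation R [set: W] n.
Variable root : 'I_n -> 'cV[R]_n.
Hypothesis root0 : forall i, root i != 0.
Hypothesis rho_simple : forall i, rho (s i) = reflmx (root i).
Hypothesis word : forall w, exists t : seq 'I_n, w = (\prod_(i <- t) s i)%g.
Hypothesis faithful : mx_faithful rho.
Implicit Types (p q : {mpoly R[n]}) (w u t : W).

Lemma rhoM u w : rho (u * w)%g = rho u *m rho w.
Proof. by rewrite repr_mxM ?inE. Qed.

Lemma rho_orth w : rho w *m (rho w)^T = 1%:M.
Proof.
have [t ->] := word w; elim: t => [|i t IHt].
  by rewrite big_nil repr_mx1 trmx1 mulmx1.
rewrite big_cons rhoM trmx_mul mulmxA -(mulmxA (rho (s i))) IHt mulmx1.
by rewrite rho_simple reflmx_tr reflmx_sqr.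
Qed.

Lemma rhoV w : rho (w^-1)%g = (rho w)^T.
Proof.
have h : rho w *m rho w^-1%g = 1%:M by rewrite -rhoM mulgV repr_mx1.
rewrite -[LHS]mul1mx -(mulmx1C (rho_orth w)) -mulmxA h mulmx1 //.
Qed.

Lemma rho_inj : injective rho.
Proof. by move=> u w; apply: (mx_faithful_inj faithful); rewrite inE. Qed.

Definition mirrors : {set W} := [set (s p.2 ^ p.1)%g | p : W * 'I_n].

(** Any normal vector of the mirror of [t] will do: another choice multiplies [mirror_poly] by a
    nonzero scalar. The default 0 is not reached for [t] in [mirrors]. *)
Definition mirror_root t : 'cV[R]_n :=
  if [pick p : W * 'I_n | t == (s p.2 ^ p.1)%g] is Some p
  then rho p.1^-1%g *m root p.2 else 0.

Lemma mirror_rootP t : t \in mirrors ->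
  mirror_root t != 0 /\ rho t = reflmx (mirror_root t).
Proof.
case/imsetP => p0 _ tE; rewrite /mirror_root.
case: pickP => [[w i] /= /eqP-> |]; last first.
  by move/(_ p0); rewrite tE eqxx.
split.
  apply: contraNneq (root0 i) => /(congr1 (mulmx (rho w))).
  by rewrite mulmxA -rhoM mulgV repr_mx1 mul1mx mulmx0 => ->.
rewrite reflmx_conj ?rho_orth // -rho_simple -rhoV invgK -!rhoM.
by rewrite conjgE mulgA.
Qed.

Lemma mirrorsJ t w : t \in mirrors -> (t ^ w)%g \in mirrors.
Proof.
case/imsetP => p _ ->; rewrite -conjgM.
by apply/imsetP; exists ((p.1 * w)%g, p.2).
Qed.

Lemma simple_mirror i : s i \in mirrors.
Proof. by apply/imsetP; exists (1%g, i) => //=; rewrite conjg1. Qed.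

Lemma sgn_mirror t : t \in mirrors -> sgn rho t = -1.
Proof. by case/mirror_rootP => t0 tE; rewrite /sgn tE det_reflmx. Qed.

Definition mirror_poly : {mpoly R[n]} := \prod_(t in mirrors) lform (mirror_root t).

Lemma mirror_poly_neq0 : mirror_poly != 0.
Proof.
by apply/prodf_neq0 => t /mirror_rootP[t0 _]; rewrite lform_eq0.
Qed.

Lemma mirror_poly_homog : mirror_poly \is #|mirrors|.-homog.
Proof.
rewrite /mirror_poly -sum1_card.
elim/big_rec2: _ => [|t k p _ hp]; first exact: dhomog1.
by apply: dhomogM => //; apply: lform_homog.
Qed.

Lemma proj_mirror_neq0 t t' : t \in mirrors -> t' \in mirrors -> t != t' ->
  linsubst (projmx (mirror_root t)) (lform (mirror_root t')) != 0.
Proof.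
move=> /mirror_rootP[a0 tE] /mirror_rootP[b0 t'E]; apply: contra_neqN.
rewrite linsubst_lform projmx_tr lform_eq0 projmxE subr_eq0 => /eqP bE.
apply: rho_inj; rewrite tE t'E bE reflmxZ //.
by apply: contraNneq b0 => k0; rewrite bE k0 scale0r.
Qed.

(** The linear forms are divided out one at a time. A skew polynomial vanishes on each mirror, while
    the forms already removed do not vanish identically on a further one, because distinct
    reflections have nonproportional roots. *)
Lemma mirror_poly_dvd_skew p : wskew rho p -> exists q, p = mirror_poly * q.
Proof.
move=> skp; rewrite /mirror_poly -big_enum.
have : {subset enum mirrors <= mirrors} by move=> t; rewrite mem_enum.
have := enum_uniq mirrors; elim: (enum _) => [_ _|t r IHr /= /andP[tr ur] sub].
  by exists p; rewrite big_nil mul1r.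
have tT : t \in mirrors by apply: sub; rewrite mem_head.
have [|q pE] := IHr ur; first by move=> t' t'r; apply: sub; rewrite inE t'r orbT.
have [t0 tE] := mirror_rootP tT.
have : linsubst (projmx (mirror_root t)) p = 0.
  apply: skew_proj0 => //; have := skp t; rewrite /wsubst tE => ->.
  by rewrite sgn_mirror // scaleN1r.
rewrite pE rmorphM rmorph_prod /= => /eqP; rewrite mulf_eq0 => /orP[|/eqP q0].
  rewrite prodf_seq_eq0 => /hasP[t' t'r]; rewrite (negPf (proj_mirror_neq0 _ _ _)) //.
    by apply: sub; rewrite inE t'r orbT.
  by apply: contraNneq tr => ->.
have [q' ->] := lform_dvd q0; exists q'.
by rewrite big_cons [RHS]mulrAC mulrC.
Qed.

(** Conjugation permutes the mirrors, so the linear forms are permuted up to scalars. The value of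
    [c] is left open here. *)
Lemma wsubst_mirror_poly w : exists c, wsubst rho w mirror_poly = c *: mirror_poly.
Proof.
have col t : t \in mirrors -> exists c,
    wsubst rho w (lform (mirror_root t)) = c *: lform (mirror_root (t ^ w)%g).
  move=> tT; have [b0 bE] := mirror_rootP (mirrorsJ w tT).
  have [a0 aE] := mirror_rootP tT.
  rewrite /wsubst linsubst_lform -rhoV; set v := rho _ *m _.
  set b := mirror_root _ in b0 bE *.
  have v0 : v != 0.
    apply: contraNneq a0 => /(congr1 (mulmx (rho w))).
    by rewrite /v mulmxA -rhoM mulgV repr_mx1 mul1mx mulmx0 => ->.
  have : reflmx v = reflmx b.
    rewrite reflmx_conj ?rho_orth // -aE -bE -rhoV invgK -!rhoM.
    by rewrite conjgE mulgA.
  (* The common reflection sends [v] to [- v], which exhibits [v] as a multiple of [b]. *)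
  move/(congr1 (mulmx^~ v)); rewrite reflmx_id // reflmxE /reflection => vE.
  exists ((2 * dot v b / dot b b) / 2); rewrite -lformZ; congr lform.
  have : 2 *: v = (2 * dot v b / dot b b) *: b.
    by rewrite scaler_nat mulr2n -{2}[v]opprK vE opprB addrC subrK.
  move/(congr1 ( *:%R 2^-1)); rewrite !scalerA mulVf ?pnatr_eq0 // scale1r => {1}->.
  by congr (_ *: _); rewrite mulrC.
have [c hc] : exists c, wsubst rho w mirror_poly =
    c *: \prod_(t in mirrors) lform (mirror_root (t ^ w)%g).
  rewrite rmorph_prod /=.
  elim/big_rec2: _ => [|t p q tT [c ->]]; first by exists 1; rewrite scale1r.
  have [c' ->] := col t tT.
  by exists (c' * c); rewrite -scalerAl -scalerAr scalerA.
exists c; rewrite hc; congr (_ *: _); rewrite /mirror_poly.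
rewrite [RHS](reindex_inj (conjg_inj w)); apply: eq_bigl => t /=.
apply/idP/idP => [|h]; first exact: mirrorsJ.
by rewrite -(conjgK w t) mirrorsJ.
Qed.

(** The scalar is read off on the mirror of [t]: once the linear form of [t], which changes sign, is
    cancelled, the restriction to that mirror is unaffected by [t], and the remaining factors do not
    vanish there. *)
Lemma wsubst_mirror_poly_simple t : t \in mirrors ->
  wsubst rho t mirror_poly = - mirror_poly.
Proof.
move=> tT; have [c hc] := wsubst_mirror_poly t; rewrite hc.
have [a0 tE] := mirror_rootP tT; set a := mirror_root t in a0 tE.
pose q := \prod_(u in mirrors | u != t) lform (mirror_root u).
have mE : mirror_poly = lform a * q by rewrite /mirror_poly (bigD1 t).
have q0 : linsubst (projmx a) q != 0.
  rewrite rmorph_prod; apply/prodf_neq0 => u /andP[uT ut] /=.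
  by apply: proj_mirror_neq0; rewrite // eq_sym.
suff -> : c = -1 by rewrite scaleN1r.
move: hc; rewrite mE /wsubst tE rmorphM /= linsubst_lform reflmx_tr reflmx_id //.
rewrite -scaleN1r lformZ scaleN1r mulNr -mulrN scalerAr.
have la0 : lform a != 0 by rewrite lform_eq0.
move/(mulfI la0)/(congr1 (linsubst (projmx a))).
rewrite linearN /= linsubstM reflmx_proj // linearZ /= => /eqP.
by rewrite -scaleN1r -subr_eq0 -scalerBl scaler_eq0 (negPf q0) orbF subr_eq0 => /eqP.
Qed.

Lemma mirror_poly_skew : wskew rho mirror_poly.
Proof.
move=> w; have [t ->] := word w; elim: t => [|i t IHt].
  by rewrite big_nil wsubst1 sgn1 scale1r.
rewrite big_cons -wsubstM wsubst_mirror_poly_simple ?simple_mirror //.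
by rewrite linearN /= IHt sgnM (sgn_mirror (simple_mirror i)) mulN1r scaleNr.
Qed.

End ReflectionGroup.

(** * Basic invariants and their Jacobian *)

Lemma mderiv_homog (R : comNzRingType) n e (p : {mpoly R[n]}) i :
  p \is e.+1.-homog -> p^`M(i) \is e.-homog.
Proof.
move=> /dhomogP pe; apply/dhomogP => m; rewrite mcoeff_msupp mcoeff_deriv.
move=> h; have : (m + U_(i))%MM \in msupp p.
  by rewrite mcoeff_msupp; apply: contraNneq h => ->; rewrite mul0rn.
by move/pe => /=; rewrite mdegD mdeg1 addn1 => -[].
Qed.

Lemma pihomog_comp (R : comNzRingType) n k (mf : measure n) (mf' : measure k) e
    (lq : n.-tuple {mpoly R[k]}) (p : {mpoly R[n]}) :
  (forall i, tnth lq i \is (mf U_(i)%MM).-homog for mf') ->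
  pihomog mf' e (p \mPo lq) = pihomog mf e p \mPo lq.
Proof.
move=> hq; rewrite comp_mpolyEX linear_sum /= (pihomogE mf e p) [RHS]raddf_sum /=.
rewrite [RHS]big_mkcond /=; apply: eq_bigr => m _; rewrite !linearZ /=.
have hm : 'X_[m] \mPo lq \is (mf m).-homog for mf'.
  by apply: dhomog_comp hq _; rewrite dhomogX.
case: eqP => [<-|/eqP ne]; first by rewrite pihomog_dE // linearZ.
by rewrite (pihomog_ne0 ne) // scaler0.
Qed.

Section Derivations.
Variables (R : idomainType) (n : nat) (v : 'I_n -> {mpoly R[n]}).

Definition derivation (p : {mpoly R[n]}) := \sum_k v k * p^`M(k).

Lemma derivation_is_linear : linear derivation.
Proof.
move=> a p q; rewrite scaler_sumr -big_split /=; apply: eq_bigr => k _.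
by rewrite linearP mulrDr scalerAr.
Qed.

HB.instance Definition _ :=
  GRing.isLinear.Build R {mpoly R[n]} {mpoly R[n]} _ derivation
    derivation_is_linear.

Lemma derivationM p q : derivation (p * q) = derivation p * q + p * derivation q.
Proof.
rewrite mulr_suml mulr_sumr -big_split /=; apply: eq_bigr => k _.
by rewrite mderivM; ring.
Qed.

Lemma derivationXn p e : derivation (p ^+ e) = p ^+ e.-1 * derivation p *+ e.
Proof.
elim: e => [|e IHe].
  rewrite expr0 mulr0n; apply: big1 => k _.
  by rewrite -mpolyC1 mderivC mulr0.
rewrite exprS derivationM IHe /= mulrnAr mulrS mulrC.
case: e {IHe} => [|e]; first by rewrite !mulr0n.
by rewrite /= mulrA -exprS.
Qed.

Lemma derivation_comp (f : n.-tuple {mpoly R[n]}) q :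
  (forall i, derivation (tnth f i) = 0) -> derivation (q \mPo f) = 0.
Proof.
move=> f0; rewrite /derivation.
under eq_bigr => k _ do rewrite mderiv_comp mulr_sumr.
rewrite exchange_big big1 //= => i _.
under eq_bigr => k _ do rewrite mulrCA.
by rewrite -mulr_sumr -/(derivation _) f0 mulr0.
Qed.

Lemma derivation_horner (mu : {poly {mpoly R[n]}}) y :
  (forall k, derivation mu`_k = 0) ->
  derivation mu.[y] = mu^`().[y] * derivation y.
Proof.
move=> mu0; rewrite horner_coef linear_sum /=.
have [sz|sz] := posnP (size mu).
  move/eqP: sz; rewrite size_poly_eq0 => /eqP ->.
  by rewrite size_poly0 big_ord0 deriv0 horner0 mul0r.
rewrite (horner_coef_wide (n := (size mu).-1)) ?size_deriv ?lt_size_deriv //; last first.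
  by rewrite -ltnS prednK // lt_size_deriv // -size_poly_gt0.
have -> : \sum_(i < size mu) derivation (mu`_i * y ^+ i) =
    \sum_(i < (size mu).-1.+1) (mu`_i * y ^+ i.-1 *+ i) * derivation y.
  rewrite prednK //; apply: eq_bigr => i _.
  by rewrite derivationM mu0 mul0r add0r derivationXn mulrnAr mulrnAl mulrA.
rewrite big_ord_recl /= mulr0n mul0r add0r mulr_suml; apply: eq_bigr => i _.
by rewrite coef_deriv /bump /= add1n /= !mulrnAl.
Qed.

End Derivations.

Section BasicInvariants.
Variables (R : realType) (n : nat) (W : finGroupType) (s : 'I_n -> W).
Variable rho : mx_representation R [set: W] n.
Variable root : 'I_n -> 'cV[R]_n.
Hypothesis root0 : forall i, root i != 0.
Hypothesis rho_simple : forall i, rho (s i) = reflmx (root i).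
Hypothesis word : forall w, exists t : seq 'I_n, w = (\prod_(i <- t) s i)%g.
Hypothesis faithful : mx_faithful rho.
Variables (f : n.-tuple {mpoly R[n]}) (m : 'I_n -> nat).
Hypothesis f_inv : forall i, winvariant rho (tnth f i).
Hypothesis f_gen : forall p, winvariant rho p -> exists q, p = q \mPo f.
Hypothesis f_indep : forall q, q \mPo f = 0 -> q = 0.
Hypothesis f_homog : forall i, tnth f i \is (m i).+1.-homog.
Implicit Types (p q : {mpoly R[n]}) (w u t : W).

Let orth := rho_orth root0 rho_simple word.
Local Notation T := (mirrors s).

Definition jacobian_mx : 'M[{mpoly R[n]}]_n := \matrix_(i, k) (tnth f i)^`M(k).
Definition jacobian := \det jacobian_mx.

Lemma jacobian_mxE w : jacobian_mx =
  map_mx (wsubst rho w) jacobian_mx *m map_mx (@mpolyC n R) (rho w).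
Proof.
apply/matrixP => i k; rewrite !mxE -{1}(f_inv i w) mderiv_linsubst.
by apply: eq_bigr => l _; rewrite !mxE.
Qed.

Lemma jacobian_skew : wskew rho jacobian.
Proof.
move=> w; have := congr1 (fun A => sgn rho w *: \det A) (jacobian_mxE w).
rewrite det_mulmx !det_map_mx -/jacobian => ->.
by rewrite -/(sgn rho w) mulrC mul_mpolyC scalerA (sgn_sqr orth) scale1r.
Qed.

Lemma jacobian_homog : jacobian \is (\sum_i m i).-homog.
Proof.
apply: rpred_sum => g _.
have -> (r : {mpoly R[n]}) : (-1) ^+ g * r = (-1) ^+ g *: r.
  by rewrite -mul_mpolyC rmorphXn rmorphN1.
apply: rpredZ; elim/big_rec2: _ => [|i k p _ hp]; first exact: dhomog1.
by apply: dhomogM => //; rewrite mxE mderiv_homog.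
Qed.

(* A vector field killing all invariants kills 'X_j, which is a simple root of
   the invariant polynomial whose roots are the conjugates of 'X_j. *)
Lemma jacobian_neq0 : jacobian != 0.
Proof.
apply/negP; rewrite -[jacobian]det_tr => /det0P[v v0 vJ].
pose D := derivation (v 0).
have Df i : D (tnth f i) = 0.
  have /rowP/(_ i) := vJ; rewrite !mxE => h; rewrite -[RHS]h.
  by apply: eq_bigr => k _; rewrite !mxE.
have Dinv p : winvariant rho p -> D p = 0.
  by case/f_gen => q ->; apply: derivation_comp.
case/negP: v0; apply/eqP/rowP => j; rewrite [RHS]mxE.
pose orbit := undup [seq wsubst rho w 'X_j | w <- enum W].
have jorb : 'X_j \in orbit.
  rewrite mem_undup; apply/mapP; exists 1%g; rewrite ?mem_enum //.
  by rewrite wsubst1.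
have orbit_uniq : uniq orbit by exact: undup_uniq.
have orbit_perm w : perm_eq [seq wsubst rho w z | z <- orbit] orbit.
  have wI : injective (wsubst rho w).
    move=> p q /(congr1 (wsubst rho w^-1%g)).
    by rewrite !wsubstM mulgV !wsubst1.
  have sub : {subset [seq wsubst rho w z | z <- orbit] <= orbit}.
    move=> z /mapP[z']; rewrite !mem_undup => /mapP[u _ ->] ->.
    by rewrite wsubstM; apply/mapP; exists (u * w)%g; rewrite ?mem_enum.
  apply: uniq_perm; rewrite ?map_inj_uniq //.
  by apply: (uniq_min_size _ sub _).2; rewrite ?map_inj_uniq // size_map.
clearbody orbit.
pose mu : {poly {mpoly R[n]}} := \prod_(z <- orbit) ('X - z%:P).
have mu_inv k : winvariant rho mu`_k.
  move=> w; rewrite -coef_map; congr (_`_k).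
  have -> : map_poly (wsubst rho w) mu =
      \prod_(z <- [seq wsubst rho w z | z <- orbit]) ('X - z%:P).
    rewrite rmorph_prod big_map; apply: eq_bigr => z _.
    by rewrite rmorphB /= map_polyX map_polyC.
  by rewrite /mu (perm_big orbit).
have muE : mu = ('X - ('X_j)%:P) * \prod_(z <- orbit | z != 'X_j) ('X - z%:P).
  by rewrite /mu (bigD1_seq _ jorb orbit_uniq).
have mu_root : mu.[ 'X_j] = 0 by rewrite muE hornerM hornerXsubC subrr mul0r.
have := derivation_horner 'X_j (fun k => Dinv _ (mu_inv k)).
rewrite mu_root linear0 => /esym/eqP; rewrite mulf_eq0 => /orP[|/eqP]; last first.
  rewrite /derivation (bigD1 j) //= mderivX mnm1E eqxx scale1r.
  rewrite big1 ?addr0 => [|k ne]; last first.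
    by rewrite mderivX mnm1E eq_sym (negPf ne) scale0r mulr0.
  have -> : (U_(j) - U_(j) = 0 :> 'X_{1..n})%MM.
    by apply/mnmP => l; rewrite mnmBE subnn mnm0E.
  by rewrite mpolyX0 mulr1.
rewrite muE derivM derivXsubC mul1r hornerD hornerM hornerXsubC subrr mul0r.
rewrite addr0 horner_prod.
rewrite prodf_seq_eq0 => /hasP[z _ /andP[ne]].
by rewrite hornerXsubC subr_eq0 eq_sym (negPf ne).
Qed.

Lemma winvariant_comp q : winvariant rho (q \mPo f).
Proof.
move=> w; rewrite /wsubst /linsubst comp_mpolyA; congr (q \mPo _).
by apply: eq_from_tnth => i; rewrite tnth_mktuple; apply: f_inv.
Qed.

(** The degree of ['X_[b] \mPo f]: with this weight, substituting the basic invariants preserves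
    homogeneity. *)
Definition degree_weight (b : 'X_{1..n}) : nat := \sum_i b i * (m i).+1.

Lemma degree_weight0 : degree_weight 0%MM = 0%N.
Proof. by apply: big1 => i _; rewrite mnm0E mul0n. Qed.

Lemma degree_weightD : {morph degree_weight : b c / (b + c)%MM >-> (b + c)%N}.
Proof.
by move=> b c; rewrite -big_split; apply: eq_bigr => i _; rewrite mnmDE mulnDl.
Qed.

HB.instance Definition _ := isMeasure.Build n degree_weight degree_weight0 degree_weightD.

Lemma degree_weightU i : degree_weight U_(i)%MM = (m i).+1.
Proof.
rewrite /degree_weight (bigD1 i) //= mnm1E eqxx mul1n big1 ?addn0 // => k ne.
by rewrite mnm1E eq_sym (negPf ne).
Qed.

(** [average] is factored as [psi] followed by composition with [f], so that its trace can be
    computed on polynomials in the invariants. Algebraic independence makes [psi p] unique, hence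
    linear in [p]. *)
Lemma preimage_subproof :
  {psi : {mpoly R[n]} -> {mpoly R[n]} | forall p, average rho p = psi p \mPo f}.
Proof.
have ex p : exists q, average rho p == q \mPo f.
  by have [q ->] := f_gen (average_invariant rho p); exists q.
by exists (fun p => xchoose (ex p)) => p; apply/eqP/(xchooseP (ex p)).
Qed.

Definition preimage := sval preimage_subproof.

Lemma preimageE p : average rho p = preimage p \mPo f.
Proof. exact: (svalP preimage_subproof). Qed.

Lemma comp_inj q q' : q \mPo f = q' \mPo f -> q = q'.
Proof.
move=> qq'; apply/eqP; rewrite -subr_eq0; apply/eqP/f_indep.
by rewrite linearB /= qq' subrr.
Qed.

Lemma preimage_is_linear : linear preimage.
Proof.
by move=> a p q; apply: comp_inj; rewrite -preimageE !linearP /= -!preimageE.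
Qed.

HB.instance Definition _ :=
  GRing.isLinear.Build R {mpoly R[n]} {mpoly R[n]} _ preimage
    preimage_is_linear.

Lemma degree_weight_positive : positive degree_weight.
Proof. by move=> i; rewrite /= degree_weightU. Qed.

Lemma comp_homog i : tnth f i \is (degree_weight U_(i)%MM).-homog.
Proof. by rewrite degree_weightU. Qed.

(* The left-hand side is |W| times the trace of a projection onto the
   invariants of degree e, which have the monomials in f as a basis. *)
Lemma gtrace_symmetrize e :
  gtrace mdeg e (symmetrize rho) = (#|W| * size (monomials degree_weight e))%:R.
Proof.
rewrite natrM; transitivity (#|W|%:R * gtrace mdeg e (average rho)).
  rewrite -gtraceZ; apply: eq_gtrace => p.
  by rewrite /average scalerA mulfV ?scale1r ?cardW_neq0.
congr (_ * _).
transitivity (gtrace mdeg e (fun p => preimage p \mPo f)).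
  by apply: eq_gtrace => p; rewrite preimageE.
rewrite (@gtrace_cyclic _ _ _ mdeg degree_weight e e (comp_mpoly f) preimage).
- transitivity (\sum_(b <- monomials degree_weight e) (1 : R)); last first.
    by rewrite big_const_seq count_predT iter_addr_0.
  apply: eq_bigr => b _.
  suff e' : preimage ('X_[b] \mPo f) = 'X_[b] by rewrite /= e' mcoeffX eqxx.
  apply: comp_inj; rewrite -preimageE average_inv //; exact: winvariant_comp.
- exact: mdeg_positive.
- exact: degree_weight_positive.
- move=> p pe; rewrite homog_piE; apply/eqP/comp_inj.
  rewrite -(pihomog_comp (mf' := mdeg)); last exact: comp_homog.
  rewrite -preimageE pihomog_dE //; apply: rpredZ; exact: symmetrize_homog.
- move=> p; apply: dhomog_comp; exact: comp_homog.
Qed.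

End BasicInvariants.

(** * The Shephard-Todd formula *)

(** Passage from series to values without convergence: since [P i] times its series is 1,
    multiplication by the product of all [P i] turns the identity of series into one of polynomials,
    which can be evaluated at [t]. *)
Lemma sum_series_horner (F : fieldType) (I : finType) (P a : I -> {poly F})
    (h : I -> nat -> F) (k : {poly F}) t :
  (forall i E, eqmodX E (P i * trunc E (h i)) 1) ->
  (forall i, (P i).[t] != 0) ->
  (forall E, eqmodX E (\sum_i a i * trunc E (h i)) k) ->
  \sum_i (a i).[t] / (P i).[t] = k.[t].
Proof.
move=> Ph Pt ah; pose PP := \prod_i P i.
have PPE i : PP = P i * \prod_(j | j != i) P j by rewrite /PP (bigD1 i).
have : \sum_i a i * \prod_(j | j != i) P j = PP * k.
  apply: eqmodX_eq => E; apply: eqmodX_trans (eqmodXM (@eqmodX_refl _ E PP) (ah E)).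
  rewrite mulr_sumr; apply: eqmodX_sum => i _.
  rewrite (PPE i); set Q := \prod_(j | _) _.
  have -> : P i * Q * (a i * trunc E (h i)) = a i * Q * (P i * trunc E (h i)) by ring.
  rewrite -[X in eqmodX _ X]mulr1; apply: eqmodXM => //.
  exact: eqmodX_sym.
move/(congr1 (fun p => p.[t])); rewrite horner_sum hornerM.
have PPt : PP.[t] != 0 by rewrite horner_prod; apply/prodf_neq0 => i _.
move=> e; apply: (mulfI PPt); rewrite -e mulr_sumr; apply: eq_bigr => i _.
rewrite hornerM (PPE i) hornerM mulrCA; congr (_ * _).
by rewrite mulrAC mulfV ?mul1r.
Qed.

Lemma prod_add_set (A : comNzRingType) n (F G : 'I_n -> A) :
  \prod_i (F i + G i) =
  \sum_(I : {set 'I_n}) (\prod_(i in I) F i) * \prod_(i in ~: I) G i.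
Proof.
rewrite bigA_distr; apply: eq_big => [I|I _]; first by rewrite inE.
rewrite (bigID (mem I)) /=; congr (_ * _); apply: eq_big => i; rewrite ?inE //.
  by move=> ->.
by move/negPf => ->.
Qed.

Lemma prod_homog (R : comNzRingType) n (I : finType) (P : pred I)
    (F : I -> {mpoly R[n]}) (k : I -> nat) :
  (forall i, F i \is (k i).-homog) ->
  \prod_(i | P i) F i \is (\sum_(i | P i) k i).-homog.
Proof.
move=> hF; elim/big_rec2: _ => [|i d p _ hp]; first exact: dhomog1.
exact: dhomogM.
Qed.

Section ShephardTodd.
Variables (R : realType) (n : nat) (W : finGroupType) (s : 'I_n -> W).
Variable rho : mx_representation R [set: W] n.
Variable root : 'I_n -> 'cV[R]_n.
Hypothesis root0 : forall i, root i != 0.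
Hypothesis rho_simple : forall i, rho (s i) = reflmx (root i).
Hypothesis word : forall w, exists t : seq 'I_n, w = (\prod_(i <- t) s i)%g.
Hypothesis faithful : mx_faithful rho.
Variables (f : n.-tuple {mpoly R[n]}) (m : 'I_n -> nat).
Hypothesis f_inv : forall i, winvariant rho (tnth f i).
Hypothesis f_gen : forall p, winvariant rho p -> exists q, p = q \mPo f.
Hypothesis f_indep : forall q, q \mPo f = 0 -> q = 0.
Hypothesis f_homog : forall i, tnth f i \is (m i).+1.-homog.
Implicit Types (p q : {mpoly R[n]}) (w u : W) (t : R).

Let orth := rho_orth root0 rho_simple word.
Local Notation T := (mirrors s).
Local Notation J := (jacobian f).
Local Notation P w := (revchar (rho w)).
Local Notation h := (fun w e => gtrace mdeg e (linsubst (rho w))).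

Let molien w E : eqmodX E (P w * trunc E (h w)) 1 :=
  @molien_series _ _ _ (orth w) E.

Let P_neq0 w t : t ^+ 2 != 1 -> (P w).[t] != 0 := revchar_neq0 (orth w) (t := t).

Lemma gtrace_symmetrizeE e : gtrace mdeg e (symmetrize rho) = \sum_w h w e.
Proof. by rewrite /symmetrize gtrace_sum. Qed.

Lemma gtrace_antisymmetrizeE e :
  gtrace mdeg e (antisymmetrize rho) = \sum_w sgn rho w * h w e.
Proof. by rewrite /antisymmetrize gtrace_sum; apply: eq_bigr => w _; rewrite gtraceZ. Qed.

(** Molien's formula: both sides describe the Hilbert series of the invariants, once by averaging
    traces and once by counting monomials in [f]. *)
Lemma sum_inv_revchar t : t ^+ 2 != 1 ->
  \prod_i (1 - t ^+ (m i).+1) * \sum_w (P w).[t]^-1 = #|W|%:R.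
Proof.
move=> t1.
pose A : {poly R} := \prod_i (1 - 'X^((m i).+1)).
have := @sum_series_horner _ _ (fun w => P w) (fun=> A) _ (#|W|%:R%:P) t molien
  (fun w => P_neq0 w t1).
rewrite hornerC => <-.
  have -> : \prod_i (1 - t ^+ (m i).+1) = A.[t].
    by rewrite horner_prod; apply: eq_bigr => i _; rewrite !hornerE.
  by rewrite mulr_sumr.
move=> E; rewrite -mulr_sumr.
(* The number of monomials of weight [e] is written as a sum of products of ones to match
   [monomial_series]. *)
have -> : \sum_w trunc E (h w) = #|W|%:R%:P *
    trunc E (fun e => \sum_(b <- monomials (degree_weight m) e) \prod_i 1 ^+ b i).
  apply/polyP => e; rewrite coef_sum coefCM coef_poly.
  under eq_bigr => w _ do rewrite coef_poly.
  case: ifP => _; last by rewrite big1 ?mulr0.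
  rewrite -gtrace_symmetrizeE (gtrace_symmetrize (rho := rho) (f := f) (m := m)) //.
  rewrite natrM; congr (_ * _).
  under eq_bigr => b _ do under eq_bigr => i _ do rewrite expr1n.
  by rewrite big_const_seq count_predT iter_addr_0 big1_eq.
rewrite mulrCA -[X in eqmodX _ _ X]mulr1; apply: eqmodXM => //.
have := @monomial_series R _ _ (fun=> 1) E (degree_weight_positive m).
under eq_bigr => i _ do rewrite scale1r /= degree_weightU.
by [].
Qed.

(** The skew polynomials are [mirror_poly] times the invariants, so their Hilbert series is that of
    the invariants shifted by [#|T|]. *)
Lemma sum_sgn_revchar t : t ^+ 2 != 1 ->
  \sum_w sgn rho w / (P w).[t] = t ^+ #|T| * \sum_w (P w).[t]^-1.
Proof.
move=> t1.
(* The right-hand side is moved to the left, so that the sum of series is a polynomial, namely 0. *)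
have := @sum_series_horner _ _ (fun w => P w)
   (fun w => (sgn rho w)%:P - 'X^#|T|) _ 0 t molien (fun w => P_neq0 w t1).
rewrite horner0 => e; apply/eqP; rewrite -subr_eq0 -[X in _ == X]e.
  rewrite mulr_sumr -sumrB; apply/eqP/eq_bigr => w _.
  by rewrite !hornerE mulrBl.
move=> E; have -> : \sum_w ((sgn rho w)%:P - 'X^#|T|) * trunc E (h w) =
   \sum_w (sgn rho w)%:P * trunc E (h w) - 'X^#|T| * \sum_w trunc E (h w).
  by rewrite mulr_sumr -sumrB; apply: eq_bigr => w _; rewrite mulrBl.
move=> k kE; rewrite coefB coefXnM !coef_sum coef0.
under eq_bigr => w _ do rewrite coefCM coef_poly kE.
rewrite -gtrace_antisymmetrizeE.
have D0 := mirror_poly_neq0 root0 rho_simple word.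
have Dsk := mirror_poly_skew root0 rho_simple word faithful.
have Dgen := mirror_poly_dvd_skew root0 rho_simple word faithful.
have Dh := mirror_poly_homog s rho root.
(* One term suffices: with [c = mirror_poly] and [d = 1] the operator is antisymmetrization
   itself. *)
have := @gtrace_skew_quotient _ _ _ _ orth _ _ D0 Dsk Dh Dgen unit
  (fun=> mirror_poly s rho root) (fun=> 1) #|T| 0 k (addn0 _) (fun=> Dh)
  (fun=> dhomog1 _ _).
rewrite !big_const !card_unit /= !addr0 mulr1 => /(_ erefl).
rewrite (@eq_gtrace _ _ _ _ _ (antisymmetrize rho)) => [->|p]; last first.
  by rewrite mul1r -skew_quotientE.
case: leqP => _; last by rewrite subrr.
rewrite gtrace_symmetrizeE -sumrB big1 // => w _.
by rewrite coef_poly (leq_ltn_trans (leq_subr _ _) kE) subrr.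
Qed.

(* Compare the two formulas for sum_w 1 / det(1 - t w) at t = 2 and t = 1/2. *)
Lemma sum_exponents : (\sum_i m i = #|T|)%N.
Proof.
pose F t := \sum_w (P w).[t]^-1.
have two1 : (2 : R) ^+ 2 != 1 by rewrite -natrX pnatr_eq1.
have half1 : (2^-1 : R) ^+ 2 != 1 by rewrite exprVn invr_eq1.
have FE := sum_inv_revchar two1; have GE := sum_inv_revchar half1.
have sE := sum_sgn_revchar two1; rewrite -/(F 2) in FE sE.
have G : \sum_w (P w).[2^-1]^-1 = (- 2) ^+ n * (2 ^+ #|T| * F 2).
  rewrite -sE mulr_sumr; apply: eq_bigr => w _.
  rewrite (revchar_recip (orth w)) ?pnatr_eq0 // -/(sgn rho w) !invfM -exprVn.
  by rewrite invrN invrK (mulr1_eq (sgn_sqr orth w)) mulrCA mulrA.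
rewrite {}G in GE; set A := \prod_i _ in FE; set B := \prod_i _ in GE.
have BA : B * 2 ^+ (\sum_i (m i).+1) = (-1) ^+ n * A.
  have -> : (-1) ^+ n = \prod_(i < n) (-1) :> R by rewrite prodr_const card_ord.
  rewrite -prodrXr -!big_split /=; apply: eq_bigr => i _.
  rewrite exprVn mulrBl mul1r mulVf ?expf_neq0 ?pnatr_eq0 //.
  by rewrite mulN1r opprB.
have : 2 ^+ (n + #|T|) = 2 ^+ (\sum_i (m i).+1) :> R.
  apply: (mulfI (cardW_neq0 R W)); rewrite -{2}GE -FE.
  transitivity (B * 2 ^+ (\sum_i (m i).+1) * ((- 2) ^+ n * (2 ^+ #|T| * F 2))).
    rewrite BA -[- 2]mulN1r exprMn exprD.
    transitivity (((-1) ^+ n * (-1) ^+ n) * (2 ^+ n * 2 ^+ #|T| * A * F 2)); last by ring.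
    by rewrite -expr2 sqrr_sign; ring.
  by rewrite mulrAC.
rewrite -!natrX => /eqP; rewrite eqr_nat eqn_exp2l // => /eqP e.
apply/eqP; rewrite -(eqn_add2l n) e.
under [X in _ == X]eq_bigr => i _ do rewrite -addn1.
by rewrite big_split /= sum1_card card_ord addnC.
Qed.

(** [J] is itself skew, hence a multiple of [mirror_poly]; by [sum_exponents] the quotient has
    degree 0, so it is a nonzero constant. *)
Lemma jacobian_dvd_skew p : wskew rho p -> exists q, p = J * q.
Proof.
have J0 := jacobian_neq0 f_gen.
have Jsk := jacobian_skew root0 rho_simple word f_inv.
have [q JE] := mirror_poly_dvd_skew root0 rho_simple word faithful Jsk.
have D0 := mirror_poly_neq0 root0 rho_simple word.
have [c qE] : exists c, q = c%:MP.
  have [h0 _] := dhomog_quotient D0 (mirror_poly_homog s rho root)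
     (eq_ind _ (fun r => r \is (\sum_i m i).-homog) (jacobian_homog f_homog) _ JE).
  rewrite sum_exponents subnn in h0; exists q@_0.
  apply/mpolyP => b; rewrite mcoeffC; case: eqP => [->|/eqP b0]; first by rewrite mulr1.
  by rewrite mulr0; apply: (dhomog_nemf_coeff h0); rewrite /= mdeg_eq0.
have c0 : c != 0 by apply: contraNneq J0 => c0; rewrite JE qE c0 mulr0.
move=> psk; have [r ->] := mirror_poly_dvd_skew root0 rho_simple word faithful psk.
exists (c^-1 *: r); rewrite JE qE -mulrA mul_mpolyC scalerA mulfV // scale1r //.
Qed.

Let J0 : J != 0 := jacobian_neq0 f_gen.
Let Jskew : wskew rho J := jacobian_skew root0 rho_simple word f_inv.

Lemma det_add_jacobian (u : R) w :
  \det (u%:MP *: jacobian_mx f + map_mx (wsubst rho w) (jacobian_mx f)) =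
  (sgn rho w * \det (1%:M + u *: rho w)) *: J.
Proof.
have -> : u%:MP *: jacobian_mx f + map_mx (wsubst rho w) (jacobian_mx f) =
    map_mx (wsubst rho w) (jacobian_mx f) *m
    map_mx (@mpolyC n R) (1%:M + u *: rho w).
  rewrite map_mxD map_mx1 map_mxZ mulmxDr mulmx1 -scalemxAr.
  by rewrite -(jacobian_mxE f_inv) addrC.
rewrite det_mulmx !det_map_mx /= -/(jacobian f) Jskew -scalerAl mulrC mul_mpolyC.
by rewrite scalerA.
Qed.

(** [I] is the set of rows taken from u D(x). They form the factor [c I g], of degree
    [\sum_(i in I) m i]; the other rows, taken from D(w x), form the factor [d I g] to which [w] is
    applied. *)
Lemma sum_det_gtrace (u : R) e :
  \sum_w \det (1%:M + u *: rho w) * h w e =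
  \sum_(I : {set 'I_n}) u ^+ #|I| *
    (if (\sum_(i in I) m i <= e)%N then \sum_w h w (e - \sum_(i in I) m i)%N else 0).
Proof.
pose c (I : {set 'I_n}) (g : 'S_n) : {mpoly R[n]} :=
  \prod_(i in I) (tnth f i)^`M(g i).
pose d (I : {set 'I_n}) (g : 'S_n) : {mpoly R[n]} :=
  (-1) ^+ g *: \prod_(i in ~: I) (tnth f i)^`M(g i).
have Jh := jacobian_homog f_homog.
pose L := skew_quotient orth jacobian_dvd_skew.
have LE p : antisymmetrize rho p = J * L p := skew_quotientE orth jacobian_dvd_skew p.
have detE w : (sgn rho w * \det (1%:M + u *: rho w)) *: J =
    \sum_(I : {set 'I_n}) (u ^+ #|I|)%:MP * \sum_g c I g * wsubst rho w (d I g).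
  under [RHS]eq_bigr => I _ do rewrite mulr_sumr.
  rewrite -det_add_jacobian exchange_big; apply: eq_bigr => g _ /=.
  under eq_bigr => i _ do rewrite !mxE.
  rewrite prod_add_set mulr_sumr; apply: eq_bigr => I _.
  rewrite big_split prodr_const /= -rmorphXn -mulrA mulrCA; congr (_ * _).
  rewrite linearZ rmorph_prod /= mulrCA; congr (_ * _).
  by rewrite -mul_mpolyC rmorphXn rmorphN1.
have opE p : \sum_w \det (1%:M + u *: rho w) *: wsubst rho w p =
    \sum_(I : {set 'I_n}) u ^+ #|I| *: \sum_g c I g * L (d I g * p).
  (* After multiplication by [J] the identity [detE] applies, and the sum over [w] becomes the
     antisymmetrization of [d I g * p], which is [J * L (d I g * p)]. *)
  apply: (mulfI J0); rewrite !mulr_sumr.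
  transitivity (\sum_w (sgn rho w)%:MP * ((\sum_(I : {set 'I_n}) (u ^+ #|I|)%:MP *
      \sum_g c I g * wsubst rho w (d I g)) * wsubst rho w p)).
    apply: eq_bigr => w _; rewrite -detE mul_mpolyC -scalerAr -scalerAl scalerA mulrA.
    by rewrite (sgn_sqr orth) mul1r.
  under eq_bigr => w _ do rewrite mulr_suml mulr_sumr.
  rewrite exchange_big; apply: eq_bigr => I _ /=.
  rewrite -mul_mpolyC mulrCA mulr_sumr mulr_sumr.
  under eq_bigr => w _ do rewrite -mulrA mulrCA mulr_suml mulr_sumr mulr_sumr.
  rewrite exchange_big; apply: eq_bigr => g _ /=.
  rewrite [J * _]mulrCA -LE !mulr_sumr; apply: eq_bigr => w _.
  by rewrite rmorphM /= -mul_mpolyC; ring.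
transitivity (gtrace mdeg e
    (fun p => \sum_w \det (1%:M + u *: rho w) *: wsubst rho w p)).
  by rewrite gtrace_sum; apply: eq_bigr => w _; rewrite gtraceZ.
rewrite (eq_gtrace _ _ opE) gtrace_sum; apply: eq_bigr => I _.
rewrite gtraceZ gtrace_sum; congr (_ * _).
rewrite (gtrace_skew_quotient orth J0 Jskew Jh jacobian_dvd_skew
   (k := (\sum_(i in I) m i)%N) (l := (\sum_(i in ~: I) m i)%N)).
- by rewrite gtrace_symmetrizeE.
- rewrite [RHS](bigID (mem I)) /=; congr (_ + _)%N.
  by apply: eq_bigl => i; rewrite inE.
- by move=> g; apply: prod_homog => i; apply: mderiv_homog.
- by move=> g; apply: rpredZ; apply: prod_homog => i; apply: mderiv_homog.
(* For every [I], the sum of [c I g * d I g] over [g] is the Leibniz expansion of [J]. *)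
apply: eq_bigr => g _; rewrite -scalerAr -mul_mpolyC rmorphXn rmorphN1.
congr (_ * _); rewrite [RHS](bigID (mem I)) /=; congr (_ * _).
  by apply: eq_bigr => i _; rewrite mxE.
by apply: eq_big => i; rewrite ?inE // mxE.
Qed.

(** [(P w).[- u]] is det(1 + u w). Expanding the product on the right yields exactly the subsets [I]
    of [sum_det_gtrace], with the same shifts of degree. *)
Lemma sum_det_revchar (u t : R) : t ^+ 2 != 1 ->
  \sum_w (P w).[- u] / (P w).[t] =
  \prod_i (1 + u * t ^+ m i) * \sum_w (P w).[t]^-1.
Proof.
move=> t1; pose A : {poly R} := \prod_i (1 + u *: 'X^(m i)).
have := @sum_series_horner _ _ (fun w => P w)
   (fun w => (P w).[- u]%:P - A) _ 0 t molien (fun w => P_neq0 w t1).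
have -> : \prod_i (1 + u * t ^+ m i) = A.[t].
  by rewrite horner_prod; apply: eq_bigr => i _; rewrite !hornerE.
rewrite horner0 => e; apply/eqP; rewrite -subr_eq0 -[X in _ == X]e.
  rewrite mulr_sumr -sumrB; apply/eqP/eq_bigr => w _.
  by rewrite !hornerE mulrBl.
move=> E; have -> : \sum_w ((P w).[- u]%:P - A) * trunc E (h w) =
   \sum_w (P w).[- u]%:P * trunc E (h w) - A * \sum_w trunc E (h w).
  by rewrite mulr_sumr -sumrB; apply: eq_bigr => w _; rewrite mulrBl.
have AE : A = \sum_(I : {set 'I_n}) u ^+ #|I| *: 'X^(\sum_(i in I) m i).
  rewrite /A; under eq_bigr => i _ do rewrite addrC.
  rewrite prod_add_set; apply: eq_bigr => I _.
  rewrite [X in _ * X]big1 // mulr1 scaler_prod prodr_const; congr (_ *: _).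
  by rewrite prodrXr.
move=> k kE; rewrite coefB coef0 AE mulr_suml !coef_sum.
under eq_bigr => w _ do rewrite coefCM coef_poly kE revchar_horner scaleNr opprK.
rewrite sum_det_gtrace -sumrB big1 // => I _.
rewrite -scalerAl coefZ coefXnM coef_sum; case: leqP => _; last by rewrite subrr.
rewrite -mulrBr -sumrB big1 ?mulr0 // => w _.
by rewrite coef_poly (leq_ltn_trans (leq_subr _ _) kE) subrr.
Qed.

End ShephardTodd.

Lemma poly_eq_horner (R : numDomainType) (p q : {poly R}) :
  (forall t : R, t ^+ 2 != 1 -> p.[t] = q.[t]) -> p = q.
Proof.
move=> pq; apply/eqP; rewrite -subr_eq0; apply/negPn/negP => d0.
(* As many roots as the size of the difference, which is one too many; starting at 2 avoids the
   excluded value 1. *)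
pose rs := [seq (k + 2)%:R : R | k <- iota 0 (size (p - q))].
have := max_poly_roots (rs := rs) d0.
rewrite size_map size_iota ltnn => /(_ _ _)/negP[] //; last first.
  by rewrite map_inj_uniq ?iota_uniq // => a b /eqP; rewrite eqr_nat eqn_add2r => /eqP.
apply/allP => _ /mapP[k _ ->]; rewrite /root hornerD hornerN pq ?subrr //.
by rewrite -natrX pnatr_eq1 addn2.
Qed.

Section ShephardToddFormula.
Variables (R : realType) (n : nat) (W : finGroupType) (s : 'I_n -> W).
Variable rho : mx_representation R [set: W] n.
Variable root : 'I_n -> 'cV[R]_n.
Hypothesis root0 : forall i, root i != 0.
Hypothesis rho_simple : forall i, rho (s i) = reflmx (root i).
Hypothesis word : forall w, exists t : seq 'I_n, w = (\prod_(i <- t) s i)%g.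
Hypothesis faithful : mx_faithful rho.
Variables (f : n.-tuple {mpoly R[n]}) (m : 'I_n -> nat).
Hypothesis f_inv : forall i, winvariant rho (tnth f i).
Hypothesis f_gen : forall p, winvariant rho p -> exists q, p = q \mPo f.
Hypothesis f_indep : forall q, q \mPo f = 0 -> q = 0.
Hypothesis f_homog : forall i, tnth f i \is (m i).+1.-homog.

Let orth := rho_orth root0 rho_simple word.
Local Notation c w := (codim_fix (rho w)).

(* With u = T (1 - t) - 1, the powers of 1 - t coming from the eigenvalue 1 of w
   cancel on the left, and on the right only w = 1 survives at t = 1. *)
Lemma sum_fix_dim (T : R) : \sum_w T ^+ (n - c w) = \prod_i (T + (m i)%:R).
Proof.
have [Q hQ] : exists Q : W -> {poly R}, forall w, (Q w).[1] != 0 /\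
    revchar (rho w) = (1 - 'X) ^+ (n - c w) * Q w.
  have ex w : exists Q : {poly R}, (Q.[1] != 0) &&
      (revchar (rho w) == (1 - 'X) ^+ (n - c w) * Q).
    by have [Q h1 h2] := revchar_factor (orth w); exists Q; rewrite h1 h2 eqxx.
  by exists (fun w => xchoose (ex w)) => w; have /andP[h1 /eqP h2] := xchooseP (ex w).
have Qn0 w t : t ^+ 2 != 1 -> (Q w).[t] != 0.
  move=> /(revchar_neq0 (orth w)); rewrite (hQ w).2 hornerM mulf_eq0 negb_or.
  by case/andP.
have hX z : (1 - 'X : {poly R}).[z] = 1 - z by rewrite !hornerE.
pose QQ w := \prod_(v | v != w) Q v.
(* [y] is -u as a polynomial in t. For this u, 1 + u t^m is (1 - t) times 1 + t + ... + t^(m-1) + T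
   t^m; cancelling the powers of 1 - t and multiplying by the product of all [Q v] gives
   [lhs = rhs], an identity of polynomials. *)
pose y : {poly R} := 1 - T *: (1 - 'X).
pose lhs := \sum_w T ^+ (n - c w) *: ((Q w \Po y) * QQ w).
pose rhs := (\prod_i (\sum_(j < m i) 'X^j + T *: 'X^(m i))) *
  \sum_w (1 - 'X) ^+ (c w) * QQ w.
have QQE w t : (\prod_v Q v).[t] = (Q w).[t] * (QQ w).[t].
  by rewrite -hornerM /QQ (bigD1 w).
have : lhs = rhs.
  apply: poly_eq_horner => t t1.
  have d0 : 1 - t != 0.
    by apply: contraNneq t1 => /eqP; rewrite subr_eq0 => /eqP <-; rewrite expr1n.
  pose u := T * (1 - t) - 1.
  have yt : y.[t] = - u by rewrite !hornerE /u opprB.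
  have QQ0 : (\prod_v Q v).[t] != 0.
    by rewrite horner_prod; apply/prodf_neq0 => v _; apply: Qn0.
  transitivity ((\prod_v Q v).[t] *
      \sum_w (revchar (rho w)).[- u] / (revchar (rho w)).[t]).
    rewrite horner_sum mulr_sumr; apply: eq_bigr => w _.
    rewrite hornerZ hornerM horner_comp yt (QQE w).
    rewrite [in (revchar _).[- u]](hQ w).2 (hQ w).2 !hornerM !horner_exp !hX.
    have -> : 1 - - u = T * (1 - t) by rewrite /u opprK addrC subrK.
    rewrite exprMn; have q0 := Qn0 w _ t1.
    have := expf_neq0 (n - c w) d0; set e := _ ^+ (n - _) => e0.
    by field; rewrite q0 e0.
  rewrite (sum_det_revchar root0 rho_simple word faithful f_inv f_gen f_indep
    f_homog u t1).
  have -> : \prod_i (1 + u * t ^+ m i) = (1 - t) ^+ n *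
      (\prod_i (\sum_(j < m i) 'X^j + T *: 'X^(m i))).[t].
    rewrite horner_prod -[n in (1 - t) ^+ n]card_ord -prodr_const -big_split /=.
    apply: eq_bigr => i _; rewrite hornerD horner_sum hornerZ hornerXn.
    under eq_bigr => j _ do rewrite hornerXn.
    have := subrX1 t (m i) => e.
    have {}e : 1 - t ^+ m i = (1 - t) * \sum_(j < m i) t ^+ j.
      by rewrite -opprB e -mulNr opprB.
    rewrite mulrDr -e /u; ring.
  rewrite /rhs hornerM horner_sum mulrCA -!mulrA [in LHS]mulrCA; congr (_ * _).
  rewrite !mulr_sumr; apply: eq_bigr => w _.
  rewrite hornerM horner_exp (QQE w) (hQ w).2 !hornerM horner_exp !hX.
  have q0 := Qn0 w _ t1; have := expf_neq0 (n - c w) d0.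
  have -> : (1 - t) ^+ n = (1 - t) ^+ (n - c w) * (1 - t) ^+ c w.
    by rewrite -exprD subnK ?codim_fix_le.
  set e := _ ^+ (n - _) => e0.
  by field; rewrite q0 e0.
move/(congr1 (fun p => p.[1])).
have QQ1 : (\prod_v Q v).[1] != 0.
  by rewrite horner_prod; apply/prodf_neq0 => v _; case: (hQ v).
rewrite /lhs /rhs horner_sum hornerM horner_prod horner_sum.
have -> : \sum_w ((1 - 'X) ^+ c w * QQ w).[1] = (\prod_v Q v).[1].
  rewrite (bigD1 1%g) //= big1 => [|w w1]; last first.
    rewrite hornerM horner_exp hX subrr expr0n.
    have -> : (c w == 0)%N = false; last by rewrite mul0r.
    apply/negbTE; rewrite /codim_fix mxrank_eq0 subr_eq0.
    apply: contraNneq w1 => w1; apply/eqP/(rho_inj faithful).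
    by rewrite -w1 repr_mx1.
  have c1 : c 1%g = 0%N by rewrite /codim_fix repr_mx1 subrr mxrank0.
  have Q1 : Q 1%g = 1.
    have := (hQ 1%g).2; rewrite c1 subn0 repr_mx1 /revchar map_mx1.
    have -> : 1%:M - 'X *: 1%:M = (1 - 'X)%:M :> 'M[{poly R}]_n.
      by rewrite scalemx1 -raddfB.
    rewrite det_scalar -[LHS]mulr1 => /esym; apply: mulfI.
    by rewrite expf_neq0 // -opprB oppr_eq0 polyXsubC_eq0.
  by rewrite addr0 hornerM c1 expr0 hornerC mul1r (QQE 1%g) Q1 hornerC mul1r.
have -> : \sum_w (T ^+ (n - c w) *: ((Q w \Po y) * QQ w)).[1] =
    (\sum_w T ^+ (n - c w)) * (\prod_v Q v).[1].
  rewrite mulr_suml; apply: eq_bigr => w _.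
  by rewrite hornerZ hornerM horner_comp (QQE w) !hornerE subrr mulr0 subr0.
move/(mulIf QQ1) => ->; apply: eq_bigr => i _.
rewrite hornerD horner_sum hornerZ hornerXn expr1n mulr1 addrC; congr (_ + _).
under eq_bigr => j _ do rewrite hornerXn expr1n.
by rewrite sumr_const card_ord.
Qed.

(** By [det_orthogonal] the sign is -1 to the codimension, so it is absorbed by replacing [x] with
    [- x]. *)
Lemma sum_sgn_fix_dim (x : R) :
  \sum_w sgn rho w * x ^+ (n - c w) = \prod_i (x - (m i)%:R).
Proof.
transitivity ((-1) ^+ n * \sum_w (- x) ^+ (n - c w)).
  rewrite mulr_sumr; apply: eq_bigr => w _.
  rewrite /sgn (det_orthogonal (orth w)) (exprNn x) mulrA; congr (_ * _).
  have -> : (-1) ^+ n = (-1) ^+ (n - c w) * (-1) ^+ c w :> R.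
    by rewrite -exprD subnK ?codim_fix_le.
  by rewrite mulrAC -expr2 sqrr_sign mul1r.
rewrite sum_fix_dim -[n in (-1) ^+ n]card_ord -prodr_const -big_split /=.
by apply: eq_bigr => i _; rewrite mulN1r opprD opprK.
Qed.

End ShephardToddFormula.

(** * Root systems and parabolic subgroups *)

Lemma gen_word (W : finGroupType) n (s : 'I_n -> W) (K : {set 'I_n}) w :
  w \in <<[set s i | i in K]>>%g ->
  exists2 t : seq 'I_n, {subset t <= K} & w = (\prod_(i <- t) s i)%g.
Proof.
case/gen_prodgP => k [c cK ->].
have ex j : exists i, (i \in K) && (c j == s i).
  by have /imsetP[i iK ->] := cK j; exists i; rewrite iK eqxx.
exists [seq xchoose (ex j) | j <- index_enum 'I_k].
  by move=> i /mapP[j _ ->]; case/andP: (xchooseP (ex j)).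
rewrite big_map; apply: eq_bigr => j _.
by case/andP: (xchooseP (ex j)) => _ /eqP.
Qed.

Section Roots.
Variables (R : realType) (n : nat) (W : finGroupType) (s : 'I_n -> W).
Variable rho : mx_representation R [set: W] n.
Variables (Phi : seq 'cV[R]_n) (Pi : n.-tuple 'cV[R]_n).
Hypothesis rr : reflection_representation rho s Phi Pi.
Hypothesis s_gen : <<[set s i | i : 'I_n]>>%g = [set: W].
Implicit Types (w u g : W) (v : 'cV[R]_n) (J K : {set 'I_n}).

Local Notation act := (act rho).
Local Notation alpha i := (tnth Pi i).
Local Notation pos := (pos_root Phi Pi).
Local Notation neg := (neg_root Phi Pi).
Local Notation prods t := (\prod_(i <- t) s i)%g.

Let rs := refl_root_system rr.
Let ss := refl_simple_system rr.

Lemma simple_in i : alpha i \in Phi.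
Proof. by apply: (simple_root ss); apply: mem_tnth. Qed.

Lemma root_in_neq0 v : v \in Phi -> v != 0.
Proof. by apply: contraTneq => ->; apply: (root_neq0 rs). Qed.

Lemma simple_neq0 i : alpha i != 0.
Proof. exact/root_in_neq0/simple_in. Qed.

Lemma rho_s i : rho (s i) = reflmx (alpha i).
Proof.
apply/matrixP => j k; have /matrixP/(_ j 0) := refl_simple rr i (delta_mx k 0).
by rewrite -reflmxE /act -!colE !mxE.
Qed.

Lemma words w : exists t : seq 'I_n, w = prods t.
Proof.
have : w \in <<[set s i | i in [set: 'I_n]]>>%g.
  have -> : [set s i | i in [set: 'I_n]] = [set s i | i : 'I_n].
    by apply/setP => x; apply/imsetP/imsetP => -[i _ ->]; exists i.
  by rewrite s_gen inE.
by case/gen_word => t _; exists t.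
Qed.

Lemma orth_rho w : rho w *m (rho w)^T = 1%:M.
Proof. exact: (rho_orth simple_neq0 rho_s words). Qed.

Lemma actM u w v : act (u * w)%g v = act u (act w v).
Proof. by rewrite /act rhoM mulmxA. Qed.

Lemma act1 v : act 1%g v = v.
Proof. by rewrite /act repr_mx1 mul1mx. Qed.

Lemma actK w v : act w^-1%g (act w v) = v.
Proof. by rewrite -actM mulVg act1. Qed.

Lemma actKV w v : act w (act w^-1%g v) = v.
Proof. by rewrite -actM mulgV act1. Qed.

Lemma act_inj w : injective (act w).
Proof. exact: can_inj (actK w). Qed.

Lemma actN w v : act w (- v) = - act w v.
Proof. by rewrite /act mulmxN. Qed.

Lemma actZ w (a : R) v : act w (a *: v) = a *: act w v.
Proof. by rewrite /act -scalemxAr. Qed.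

Lemma act_sum w I (r : seq I) (P : pred I) (F : I -> 'cV[R]_n) :
  act w (\sum_(i <- r | P i) F i) = \sum_(i <- r | P i) act w (F i).
Proof. by rewrite /act mulmx_sumr. Qed.

Lemma dot_act w (a b : 'cV[R]_n) : dot (act w a) (act w b) = dot a b.
Proof.
by rewrite /act dot_mulmx mulmxA (mulmx1C (orth_rho w)) mul1mx.
Qed.

Lemma dot_actV w (a b : 'cV[R]_n) : dot (act w a) b = dot a (act w^-1%g b).
Proof. by rewrite -(dot_act w^-1%g) actK. Qed.

Lemma act_s i v :
  act (s i) v = v - (2 * dot v (alpha i) / dot (alpha i) (alpha i)) *: alpha i.
Proof. exact: (refl_simple rr). Qed.

Lemma act_s_simple i : act (s i) (alpha i) = - alpha i.
Proof. by rewrite /act rho_s reflmx_id ?simple_neq0. Qed.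

Lemma s_sqr i : (s i * s i)%g = 1%g.
Proof.
apply: (rho_inj (refl_faithful rr)).
by rewrite rhoM rho_s reflmx_sqr ?simple_neq0 // repr_mx1.
Qed.

Lemma act_in w v : v \in Phi -> act w v \in Phi.
Proof.
have [t ->] := words w; elim: t v => [|i t IHt] v vPhi.
  by rewrite big_nil act1.
rewrite big_cons actM (refl_simple rr).
by apply: (root_stable rs); [apply: simple_in | apply: IHt].
Qed.

Lemma coord_sum v : v = \sum_i coord Pi i v *: alpha i.
Proof.
rewrite {1}(coord_basis (simple_basis ss) (memvf v)).
by apply: eq_bigr => i _; rewrite (tnth_nth 0).
Qed.

Lemma coord_simple i j : coord Pi i (alpha j) = (i == j)%:R.
Proof.
by rewrite (tnth_nth 0) coord_free ?(basis_free (simple_basis ss)) // eq_sym.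
Qed.

Lemma coord_act_s i j v : i != j -> coord Pi i (act (s j) v) = coord Pi i v.
Proof.
by move=> ij; rewrite act_s linearB linearZ /= coord_simple (negPf ij) mulr0 subr0.
Qed.

Lemma coord_prods (t : seq 'I_n) K i v : {subset t <= K} -> i \notin K ->
  coord Pi i (act (prods t) v) = coord Pi i v.
Proof.
move=> tK iK; elim: t tK => [|j t IHt] tK; first by rewrite big_nil act1.
rewrite big_cons actM coord_act_s.
  by apply: IHt => k kt; apply: tK; rewrite inE kt orbT.
by apply: contraNneq iK => ->; apply: tK; rewrite mem_head.
Qed.

Lemma root_pos_or_neg v : v \in Phi -> pos v || neg v.
Proof. exact: (simple_sign ss). Qed.

Lemma pos_in v : pos v -> v \in Phi. Proof. by case/andP. Qed.
Lemma neg_in v : neg v -> v \in Phi. Proof. by case/andP. Qed.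
Lemma pos_coord v i : pos v -> 0 <= coord Pi i v.
Proof. by case/andP => _ /forallP. Qed.
Lemma neg_coord v i : neg v -> coord Pi i v <= 0.
Proof. by case/andP => _ /forallP. Qed.

Lemma pos_nneg v : pos v -> neg v = false.
Proof.
move=> vp; apply/negP => vn; have := root_in_neq0 (pos_in vp).
rewrite (coord_sum v) big1 ?eqxx // => i _.
suff -> : coord Pi i v = 0 by rewrite scale0r.
by apply/eqP; rewrite eq_le pos_coord // neg_coord.
Qed.

Lemma nneg_pos v : v \in Phi -> ~~ neg v = pos v.
Proof.
move=> vPhi; case/orP: (root_pos_or_neg vPhi) => h; first by rewrite h pos_nneg.
by rewrite h; apply/esym/negbTE; apply: contraTN h => /pos_nneg ->.
Qed.

Lemma root_opp v : v \in Phi -> - v \in Phi.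
Proof.
by move=> vPhi; rewrite -scaleN1r (root_line rs) // eqxx orbT.
Qed.

Lemma negN v : neg (- v) = pos v.
Proof.
have -> : neg (- v) = (- v \in Phi) && [forall i, 0 <= coord Pi i v].
  by congr (_ && _); apply: eq_forallb => i; rewrite linearN oppr_le0.
congr (_ && _); apply/idP/idP => [/root_opp|]; first by rewrite opprK.
exact: root_opp.
Qed.

Lemma simple_pos i : pos (alpha i).
Proof.
rewrite /pos_root simple_in; apply/forallP => j.
by rewrite coord_simple ler0n.
Qed.

Lemma pos_eq_simple i v : pos v -> (forall j, j != i -> coord Pi j v = 0) ->
  v = alpha i.
Proof.
move=> vp v0; have vE : v = coord Pi i v *: alpha i.
  rewrite {1}(coord_sum v) (bigD1 i) //= big1 ?addr0 // => j ji.
  by rewrite v0 // scale0r.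
have := pos_in vp; rewrite {1}vE (root_line rs) ?simple_in //.
case/orP => /eqP c1; first by rewrite vE c1 scale1r.
by have := pos_coord i vp; rewrite c1 ler0N1.
Qed.

(** [s i] changes only the [i]-th coordinate, so a positive root that becomes negative has no other
    nonzero coordinate. *)
Lemma act_s_pos i v : pos v -> v != alpha i -> pos (act (s i) v).
Proof.
move=> vp; apply: contraNT; rewrite -nneg_pos ?act_in ?pos_in // negbK => vn.
apply/eqP/pos_eq_simple => // j ji.
by apply/eqP; rewrite eq_le pos_coord // andbT -(coord_act_s _ ji) neg_coord.
Qed.

Lemma s_conj w i j : act w (alpha i) = alpha j -> (w * s i)%g = (s j * w)%g.
Proof.
move=> wij; apply: (rho_inj (refl_faithful rr)); rewrite !rhoM !rho_s -wij /act.
by rewrite reflmx_conj ?orth_rho // -!mulmxA (mulmx1C (orth_rho w)) mulmx1.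
Qed.

(** The exchange condition. The deleted letter is the one at which the image of [alpha i], computed
    from the right, turns negative; just before it, the image must be the simple root of that
    letter. *)
Lemma exchange (t : seq 'I_n) i : neg (act (prods t) (alpha i)) ->
  exists t' : seq 'I_n, [/\ size t = (size t').+1, {subset t' <= t}
    & (prods t * s i)%g = prods t'].
Proof.
elim: t => [|j t IHt].
  by rewrite big_nil act1 pos_nneg ?simple_pos.
rewrite big_cons actM => wn.
case un: (neg (act (prods t) (alpha i))).
  have [t' [st sub tE]] := IHt un; exists (j :: t'); split.
  - by rewrite /= st.
  - by move=> k; rewrite !inE => /orP[->//|/sub ->]; rewrite orbT.
  - by rewrite big_cons -mulgA tE.
have up : pos (act (prods t) (alpha i)).
  by rewrite -nneg_pos ?un ?act_in ?simple_in.
exists t; split=> //; first by move=> k kt; rewrite inE kt orbT.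
have uE : act (prods t) (alpha i) = alpha j.
  apply/eqP; apply: contraTT wn => ne.
  by rewrite pos_nneg // act_s_pos.
by rewrite -mulgA (s_conj uE) mulgA s_sqr mul1g.
Qed.

(** If [i] is the last letter of a word for [w], the word without it makes [alpha i] negative, and
    the exchange condition shortens the given word by two letters. *)
Lemma pos_eq1 w : (forall i, pos (act w (alpha i))) -> w = 1%g.
Proof.
have [t ->] := words w; have [k] := ubnP (size t).
elim: k t => // k IHk t; case: (lastP t) => [|t' i]; first by rewrite big_nil.
rewrite size_rcons ltnS -cats1 big_cat big_seq1 /= => tk tpos.
have := tpos i; rewrite actM act_s_simple actN -negN opprK => un.
have [t'' [st _ tE]] := exchange un.
move: tpos; rewrite tE => tpos; apply: (IHk t'') => //.
by apply: ltn_trans tk; rewrite st.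
Qed.

(** * Parabolic subgroups and dominant vectors *)

Local Notation WJ J := <<[set s i | i in J]>>%g.

Lemma s_in J j : j \in J -> s j \in WJ J.
Proof. by move=> jJ; apply: mem_gen; apply: imset_f. Qed.

Lemma prods_in (t : seq 'I_n) J : {subset t <= J} -> prods t \in WJ J.
Proof.
elim: t => [|j t IHt] tJ; first by rewrite big_nil group1.
rewrite big_cons groupM ?s_in ?tJ ?mem_head //.
by apply: IHt => k kt; apply: tJ; rewrite inE kt orbT.
Qed.

Lemma coord_WJ J u i v : u \in WJ J -> i \notin J ->
  coord Pi i (act u v) = coord Pi i v.
Proof. by case/gen_word => t tJ -> iJ; apply: (coord_prods _ tJ iJ). Qed.

Lemma WJ_simple_sum J u j : u \in WJ J -> j \in J ->
  act u (alpha j) = \sum_(k in J) coord Pi k (act u (alpha j)) *: alpha k.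
Proof.
move=> uJ jJ; rewrite {1}(coord_sum (act u _)) [RHS]big_mkcond.
apply: eq_bigr => k _; case: ifP => // /negbT kJ.
rewrite (coord_WJ _ uJ kJ) coord_simple.
by case: eqP kJ => [->|_]; rewrite ?jJ // scale0r.
Qed.

Lemma WJ_pos_eq1 J u : u \in WJ J -> (forall j, j \in J -> pos (act u (alpha j))) ->
  u = 1%g.
Proof.
move=> uJ upos; apply: pos_eq1 => i.
have [/upos //|iJ] := boolP (i \in J).
rewrite -nneg_pos ?act_in ?simple_in //; apply/negP => /(neg_coord i).
by rewrite (coord_WJ _ uJ iJ) coord_simple eqxx ler10.
Qed.

(** The basis dual to [Pi]; it turns coordinates into scalar products, to which the invariance of
    [dot] applies. *)
Definition coweight i : 'cV[R]_n := \col_k coord Pi i (delta_mx k 0).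

Lemma dot_coweight i v : dot v (coweight i) = coord Pi i v.
Proof.
have {2}-> : v = \sum_k v k 0 *: delta_mx k 0.
  rewrite {1}(matrix_sum_delta v); apply: eq_bigr => k _.
  by rewrite big_ord_recl big_ord0 addr0.
rewrite linear_sum; apply: eq_bigr => k _.
by rewrite linearZ /= mxE.
Qed.

(* A point of the open dominant chamber. *)
Definition coweight_sum : 'cV[R]_n := \sum_i coweight i.

Lemma dot_coweight_sum v : dot v coweight_sum = \sum_i coord Pi i v.
Proof.
rewrite dotC dot_suml; apply: eq_bigr => i _.
by rewrite dotC dot_coweight.
Qed.

Lemma dot_coweight_neg v : neg v -> dot v coweight_sum < 0.
Proof.
move=> vn; rewrite dot_coweight_sum lt_neqAle sumr_le0 ?andbT; last first.
  by move=> i _; apply: neg_coord.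
apply/negP => /eqP s0; have := root_in_neq0 (neg_in vn).
rewrite (coord_sum v) big1 ?eqxx // => i _.
suff -> : coord Pi i v = 0 by rewrite scale0r.
apply: oppr_inj; rewrite oppr0; move/(congr1 -%R): s0; rewrite oppr0 -sumrN => s0.
by apply: (psumr_eq0P _ s0) => // k _; rewrite oppr_ge0 neg_coord.
Qed.

(** Choose [g] with [dot (act g v) coweight_sum] maximal. Since [alpha j] has product 1 with
    [coweight_sum], a further [s j] subtracts a positive multiple of [dot (act g v) (alpha j)]. *)
Lemma dominant_exists J v :
  exists2 g, g \in WJ J & forall j, j \in J -> 0 <= dot (act g v) (alpha j).
Proof.
pose g := [arg max_(g > 1%g in WJ J) dot (act g v) coweight_sum]%O.
exists g; rewrite /g; case: arg_maxP => [|h hJ hmax]; rewrite ?group1 //.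
move=> j jJ; have := hmax (s j * h)%g (groupM (s_in jJ) hJ).
rewrite actM act_s dotDl dotNl dotZl /= lerBlDl lerDr.
have -> : dot (alpha j) coweight_sum = 1.
  rewrite dot_coweight_sum (bigD1 j) //= coord_simple eqxx big1 ?addr0 // => i ij.
  by rewrite coord_simple (negPf ij).
rewrite mulr1 -mulrA pmulr_rge0 // pmulr_lge0 // invr_gt0.
exact/dot_gt0/simple_neq0.
Qed.

(** If [u] fixes [v] and makes [alpha i] negative, then [dot v (alpha i)], which equals
    [dot v (act u (alpha i))], is both nonnegative and nonpositive. So [s i] fixes [v] and can be
    split off from the right. *)
Lemma stabilizer_dominant K v (t : seq 'I_n) : {subset t <= K} ->
  (forall k, k \in K -> 0 <= dot v (alpha k)) -> act (prods t) v = v ->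
  prods t \in WJ [set k in K | dot v (alpha k) == 0].
Proof.
move=> tK vdom; have [k] := ubnP (size t); elim: k t tK => // k IHk t tK tk tv.
have uK := prods_in tK; set u := prods t in uK tv *.
have [/forall_inP upos|] := boolP [forall i in K, pos (act u (alpha i))].
  by rewrite (WJ_pos_eq1 uK upos) group1.
case/forall_inPn => i iK; rewrite -nneg_pos ?act_in ?simple_in // negbK => un.
have [t' [st sub tE]] := exchange un.
have vi : dot v (alpha i) = 0.
  apply/eqP; rewrite eq_le vdom // andbT.
  rewrite -(dot_act u) tv (WJ_simple_sum uK iK) dotC dot_suml sumr_le0 // => j jK.
  by rewrite dotZl mulr_le0_ge0 ?neg_coord // dotC vdom.
have siv : act (s i) v = v by rewrite act_s vi mulr0 mul0r scale0r subr0.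
have ut' : u = (prods t' * s i)%g by rewrite -tE -mulgA s_sqr mulg1.
rewrite ut' groupM //; last by apply: s_in; rewrite inE iK vi eqxx.
apply: IHk; first by move=> j /sub /tK.
  by rewrite -ltnS; apply: leq_trans tk; rewrite st.
by rewrite -tE actM siv.
Qed.

(** * Representatives of the cosets of a parabolic subgroup *)

Lemma mem_X J w : (w \in X_ rho Phi Pi J) = [forall j in J, pos (act w (alpha j))].
Proof.
rewrite inE; apply/eqP/forall_inP => [/setP D j jJ|wpos].
  have := D j; rewrite !inE jJ andbT => /negbT.
  by rewrite nneg_pos ?act_in ?simple_in.
apply/setP => j; rewrite !inE; apply/negP => /andP[wn jJ].
by have := wpos j jJ; rewrite -nneg_pos ?wn ?act_in ?simple_in.
Qed.

(** If [g] makes the image of [coweight_sum] under [w^-1] dominant for [J], then the image of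
    [alpha j] under [w g^-1] has nonnegative product with [coweight_sum], which no negative root
    has. *)
Lemma X_WJ_exists J w : exists2 u, u \in WJ J & (w * u)%g \in X_ rho Phi Pi J.
Proof.
have [g gJ gpos] := dominant_exists J (act w^-1%g coweight_sum).
exists g^-1%g; first by rewrite groupV.
rewrite mem_X; apply/forall_inP => j jJ.
rewrite -nneg_pos ?act_in ?simple_in //; apply/negP => /dot_coweight_neg.
rewrite dot_actV invMg invgK actM dotC; have := gpos j jJ.
by rewrite leNgt => /negPf ->.
Qed.

Lemma neg_sum v (c : 'I_n -> R) (F : 'I_n -> 'cV[R]_n) (P : pred 'I_n) :
  v \in Phi -> v = \sum_(i | P i) c i *: F i -> (forall i, P i -> c i <= 0) ->
  (forall i, P i -> pos (F i)) -> neg v.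
Proof.
move=> vPhi vE cle Fpos; rewrite /neg_root vPhi; apply/forallP => i.
rewrite vE linear_sum sumr_le0 // => j Pj.
by rewrite linearZ /= mulr_le0_ge0 ?cle ?pos_coord ?Fpos.
Qed.

(** A nontrivial [u] sends some [alpha j] with [j] in [J] to a nonpositive combination of simple
    roots in [J], and [v] keeps all of these positive. *)
Lemma X_WJ_uniq J (v u : W) : v \in X_ rho Phi Pi J -> (v * u)%g \in X_ rho Phi Pi J ->
  u \in WJ J -> u = 1%g.
Proof.
rewrite !mem_X => /forall_inP vpos /forall_inP vupos uJ.
apply: (WJ_pos_eq1 uJ) => j jJ; rewrite -nneg_pos ?act_in ?simple_in //.
apply/negP => un; have := vupos j jJ; rewrite -nneg_pos ?act_in ?simple_in //.
apply/negP; rewrite negbK actM.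
apply: (neg_sum (c := fun k => coord Pi k (act u (alpha j)))
         (F := fun k => act v (alpha k)) (P := mem J)) => //.
- by rewrite !act_in ?simple_in.
- rewrite {1}(WJ_simple_sum uJ jJ) act_sum; apply: eq_bigr => k _.
  by rewrite actZ.
by move=> k _; apply: neg_coord.
Qed.

Lemma WJ_fix J u v : u \in WJ J -> (forall j, j \in J -> dot v (alpha j) = 0) ->
  act u v = v.
Proof.
case/gen_word => t tJ -> v0; elim: t tJ => [|j t IHt] tJ.
  by rewrite big_nil act1.
rewrite big_cons actM IHt => [|k kt]; last by apply: tJ; rewrite inE kt orbT.
by rewrite act_s v0 ?mulr0 ?mul0r ?scale0r ?subr0 // tJ ?mem_head.
Qed.

(** Only one inclusion is stated: by [WJ_fix], an element of [WJ K] fixes the orthogonal of [K]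
    anyway. *)
Definition elliptic K u := u \in WJ K /\
  (forall v, act u v = v -> forall k, k \in K -> dot v (alpha k) = 0).

(* Take K minimal such that a conjugate of w lies in W_K: a vector fixed by w
   and not orthogonal to K would, once made dominant, have a smaller stabilizer. *)
Lemma elliptic_exists w : exists K g, elliptic K (w ^ g)%g.
Proof.
pose P (K : {set 'I_n}) := [exists g, (w ^ g)%g \in WJ K].
have PT : P [set: 'I_n].
  apply/existsP; exists 1%g; rewrite conjg1.
  by have [t ->] := words w; apply: prods_in => i _; rewrite inE.
pose K := [arg min_(K < [set: 'I_n] | P K) #|K|].
have [PK Kmin] : P K /\ forall K', P K' -> (#|K| <= #|K'|)%N.
  by rewrite /K; case: arg_minnP.
case/existsP: PK => g gK; exists K.
exists g; split=> // v vfix.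
have [h hK hdom] := dominant_exists K v.
pose K' := [set k in K | dot (act h v) (alpha k) == 0].
have K'K : K' = K.
  apply/eqP; rewrite eqEcard; apply/andP; split.
    by apply/subsetP => k; rewrite inE => /andP[].
  apply: Kmin; apply/existsP; exists (g * h^-1)%g; rewrite conjgM.
  have hwK : ((w ^ g) ^ h^-1)%g \in WJ K by rewrite groupJ ?groupV.
  have [t tK tE] := gen_word hwK; rewrite tE; apply: stabilizer_dominant => //.
  rewrite -tE conjgE invgK mulgA actM actK actM vfix //.
have hv0 k : k \in K -> dot (act h v) (alpha k) = 0.
  by rewrite -{1}K'K inE => /andP[_ /eqP].
have hv : act h v = v.
  have h1 := WJ_fix (groupVr hK) hv0; rewrite actK in h1.
  exact: esym h1.
by move=> k /hv0; rewrite hv.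
Qed.

(** The coweights outside [J] are fixed by v^-1 u v, so by ellipticity they are orthogonal to b =
    v^-1(alpha k), which therefore lies in the span of [J]. This writes [alpha k] as a nonnegative
    combination of the positive roots v(alpha j); a simple root is indecomposable, so it is one of
    them. *)
Lemma elliptic_X_equiv J K (u v : W) : elliptic K u -> v \in X_ rho Phi Pi J ->
  ((u ^ v)%g \in WJ J) =
  [forall k in K, act v^-1%g (alpha k) \in [seq alpha j | j in J]].
Proof.
move=> [uK ufix]; rewrite mem_X => /forall_inP vpos.
apply/idP/forall_inP => [uJ k kK|vK]; last first.
  have [t tK ->] := gen_word uK; elim: t tK => [|k t IHt] tK.
    by rewrite big_nil conj1g group1.
  rewrite big_cons conjMg groupM ?IHt //; last first.
    by move=> i it; apply: tK; rewrite inE it orbT.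
  have /imageP[j jJ jE] := vK k (tK k (mem_head _ _)).
  have /s_conj vs : act v (alpha j) = alpha k by rewrite -jE actKV.
  by rewrite conjgE -vs mulKg s_in.
set b := act v^-1%g (alpha k).
have bPhi : b \in Phi by rewrite act_in ?simple_in.
have b0 i : i \notin J -> coord Pi i b = 0.
  move=> iJ; rewrite -dot_coweight /b dot_actV invgK dotC.
  apply: (ufix _ _ k kK); rewrite -actM conjgC actM; congr act.
  apply: (WJ_fix uJ) => j jJ.
  by rewrite dotC dot_coweight coord_simple; case: eqP iJ => // ->; rewrite jJ.
have kE : alpha k = \sum_(j in J) coord Pi j b *: act v (alpha j).
  rewrite -{1}(actKV v (alpha k)) -/b {1}(coord_sum b) act_sum [RHS]big_mkcond.
  apply: eq_bigr => j _; rewrite actZ; case: ifP => // /negbT jJ.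
  by rewrite b0 // scale0r.
have bpos : pos b.
  rewrite -nneg_pos //; apply/negP => bn.
  suff : neg (alpha k) by rewrite pos_nneg ?simple_pos.
  by apply: (neg_sum (simple_in k) kE) => // j _; apply: neg_coord.
have /existsP[j /andP[jJ cj]] : [exists j, (j \in J) && (coord Pi j b != 0)].
  apply: contraT; rewrite negb_exists => /forallP bz.
  case/eqP: (root_in_neq0 bPhi); rewrite (coord_sum b) big1 // => j _.
  have := bz j; rewrite negb_and negbK => /orP[jJ|/eqP->]; last by rewrite scale0r.
  by rewrite b0 // scale0r.
apply/imageP; exists j => //; apply: (act_inj (w := v)); rewrite actKV.
apply/esym/pos_eq_simple => [|i ik]; first exact: vpos.
have : coord Pi i (alpha k) = 0 by rewrite coord_simple (negPf ik).
rewrite kE linear_sum; under eq_bigr => l _ do rewrite linearZ.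
move=> s0; have /eqP : coord Pi j b * coord Pi i (act v (alpha j)) = 0.
  apply: (psumr_eq0P _ s0) => // l lJ.
  by rewrite mulr_ge0 // pos_coord // vpos.
by rewrite mulf_eq0 (negPf cj) => /eqP.
Qed.

(** The nonzero rows of [D *m A] are the simple roots in [K], so its rank is [#|K|]; its kernel, the
    orthogonal of [K], is also the kernel of [1 - rho u]. *)
Lemma elliptic_codim K u : elliptic K u -> codim_fix (rho u) = #|K|.
Proof.
move=> [uK ufix].
pose A : 'M[R]_n := \matrix_(i, j) (alpha i) j 0.
pose D : 'M[R]_n := diag_mx (\row_i (i \in K)%:R).
have rA : row_full A.
  rewrite row_full_unit unitmxE unitfE; apply/negP => /eqP detA.
  have /eqP := detA; rewrite -det_tr => /det0P[v v0 vA].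
  have A0 i : dot v^T (alpha i) = 0.
    have /rowP/(_ i) := vA; rewrite !mxE => h; rewrite -[RHS]h.
    by apply: eq_bigr => k _; rewrite !mxE.
  case/eqP: v0; apply: trmx_inj; rewrite trmx0; apply/eqP; rewrite -dot_eq0.
  rewrite {2}(coord_sum v^T) dotC dot_suml big1 // => i _.
  by rewrite dotZl dotC A0 mulr0.
have rDA : \rank (D *m A) = #|K|.
  rewrite mxrankMfree ?mxrank_diag; last by rewrite row_free_unit -row_full_unit.
  apply: eq_card => i; rewrite inE !mxE pnatr_eq0.
  by case: (i \in K).
have kerP (v : 'cV[R]_n) : (D *m A *m v = 0) <-> ((1%:M - rho u) *m v = 0).
  have eE i : (D *m A *m v) i 0 = (i \in K)%:R * dot v (alpha i).
    rewrite -mulmxA mul_diag_mx !mxE; congr (_ * _).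
    by apply: eq_bigr => k _; rewrite !mxE mulrC.
  rewrite mulmxBl mul1mx; split=> [D0|/eqP].
    rewrite -/(act u v) (WJ_fix uK) ?subrr // => j jK.
    by have := eE j; rewrite D0 mxE jK mul1r.
  rewrite subr_eq0 => /eqP fixv; apply/matrixP => i j; rewrite ord1 eE mxE.
  case iK: (i \in K); last by rewrite mul0r.
  by rewrite (ufix v) ?mulr0 // /act -fixv.
have sub (B C : 'M[R]_n) : (forall v : 'cV[R]_n, C *m v = 0 -> B *m v = 0) -> (B <= C)%MS.
  move=> h; rewrite submxE; apply/eqP/matrixP => i j.
  have /matrixP/(_ i 0) : B *m col j (cokermx C) = 0.
    by apply: h; rewrite colE mulmxA mulmx_coker mul0mx.
  by rewrite colE mulmxA -colE !mxE.
rewrite /codim_fix -rDA; apply/eqP; rewrite eqn_leq !mxrankS //.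
  by apply: sub => v /kerP.
by apply: sub => v /kerP.
Qed.

(** * Coxeter length and the longest element *)

Lemma short_word w : exists2 t : seq 'I_n, (size t < #|W|)%N & w = prods t.
Proof.
have ex : exists k, [exists t : k.-tuple 'I_n, w == prods t].
  have [t tE] := words w; exists (size t); apply/existsP; exists (in_tuple t).
  by rewrite tE.
case: (ex_minnP ex) => k /existsP[t /eqP tE] kmin.
exists t; rewrite // size_tuple.
pose prefixes := [seq prods (take j t) | j <- iota 0 k.+1].
suff /card_uniqP pu : uniq prefixes.
  by have := max_card (mem prefixes); rewrite pu size_map size_iota.
have short a b : (a < b)%N -> (b <= k)%N -> prods (take a t) <> prods (take b t).
  move=> ab bk eab; pose t' := take a t ++ drop b t.
  have st' : size t' = (a + (k - b))%N.
    rewrite size_cat size_drop size_tuple size_takel // size_tuple.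
    exact: leq_trans (ltnW ab) bk.
  have : (k <= size t')%N.
    apply: kmin; apply/existsP; exists (in_tuple t') => /=.
    by rewrite big_cat /= eab -big_cat cat_take_drop /= -tE.
  rewrite st' leqNgt => /negP[].
  by rewrite -[X in (_ < X)%N](subnKC bk) ltn_add2r.
rewrite map_inj_in_uniq ?iota_uniq // => a b; rewrite !mem_iota /= !ltnS => ak bk eab.
by case: (ltngtP a b) => // [/short/(_ bk)|/short/(_ ak)]; [|move/nesym]; rewrite eab.
Qed.

(** By [short_word] the search in [cox_length] succeeds, so [find] does not return its default, the
    size of the list. *)
Lemma cox_lengthP w : (exists2 t : seq 'I_n, size t = cox_length s w & w = prods t)
  /\ (forall t : seq 'I_n, w = prods t -> (cox_length s w <= size t)%N).
Proof.
rewrite /cox_length; set p := (fun k => [exists t : k.-tuple 'I_n, w == prods t]).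
have pP (t : seq 'I_n) : w = prods t -> p (size t).
  by move=> tE; apply/existsP; exists (in_tuple t); rewrite /= -tE.
have hp : has p (iota 0 #|W|).
  have [t st tE] := short_word w; apply/hasP; exists (size t); last exact: pP.
  by rewrite mem_iota.
have flt : (find p (iota 0 #|W|) < #|W|)%N.
  by rewrite -[X in (_ < X)%N](size_iota 0) -has_find.
split.
  have := nth_find 0%N hp; rewrite nth_iota // add0n => /existsP[t /eqP tE].
  by exists t; rewrite // size_tuple.
move=> t tE; rewrite leqNgt; apply/negP => lt.
have := before_find 0%N lt; rewrite nth_iota ?add0n ?pP //.
exact: ltn_trans lt flt.
Qed.

(** Otherwise a shortest word of [w0 * s i] makes [alpha i] negative, and the exchange condition
    produces from it a shorter word for [w0], against maximality. *)
Lemma longest_neg w0 i : longest s w0 -> neg (act w0 (alpha i)).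
Proof.
move=> w0max; apply: contraT; rewrite nneg_pos ?act_in ?simple_in // => w0i.
have [[t st tE] _] := cox_lengthP (w0 * s i)%g.
have [|t' [st' _ t'E]] := @exchange t i.
  by rewrite -tE actM act_s_simple actN negN.
have := (cox_lengthP w0).2 t'; rewrite -t'E -tE -mulgA s_sqr mulg1 => /(_ erefl).
rewrite leqNgt => /negP[]; rewrite -ltnS -st' st ltnS; apply: w0max.
Qed.

End Roots.

(** * Descent classes *)

Section Descents.
Variables (R : realType) (n : nat) (W : finGroupType) (s : 'I_n -> W).
Variable rho : mx_representation R [set: W] n.
Variables (Phi : seq 'cV[R]_n) (Pi : n.-tuple 'cV[R]_n).
Hypothesis rr : reflection_representation rho s Phi Pi.
Hypothesis s_gen : <<[set s i | i : 'I_n]>>%g = [set: W].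
Implicit Types (w u g v : W) (J K T : {set 'I_n}).

Local Notation act := (act rho).
Local Notation alpha i := (tnth Pi i).
Local Notation X J := (X_ rho Phi Pi J).
Local Notation WJ J := <<[set s i | i in J]>>%g.
Local Notation equiv := (simple_equiv rho Pi).
Local Notation cls := (class_of rho Pi).

Let actK w := actK rho w.
Let actKV w := actKV rho w.

Lemma alpha_inj : injective (fun i => alpha i).
Proof.
apply/tuple_uniqP; apply: free_uniq.
exact: basis_free (simple_basis (refl_simple_system rr)).
Qed.

Lemma equivP K1 K2 : reflect
  (exists w, (forall k, k \in K1 -> exists2 l, l \in K2 & act w (alpha k) = alpha l) /\
     (forall l, l \in K2 -> exists2 k, k \in K1 & act w (alpha k) = alpha l))
  (equiv K1 K2).
Proof.
apply: (iffP existsP) => -[w].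
  move/perm_mem => e; exists w; split=> [k kK|l lK].
    have : act w (alpha k) \in [seq alpha i | i in K2] by rewrite -e image_f.
    by case/imageP => l lK ->; exists l.
  have : alpha l \in [seq act w (alpha i) | i in K1] by rewrite e image_f.
  by case/imageP => k kK ->; exists k.
case=> h1 h2; exists w; apply: uniq_perm.
- rewrite map_inj_uniq ?enum_uniq // => i j /(act_inj (rho := rho)).
  exact: alpha_inj.
- by rewrite map_inj_uniq ?enum_uniq //; apply: alpha_inj.
move=> x; apply/imageP/imageP => -[i iK ->].
  by have [l lK e] := h1 i iK; exists l.
by have [k kK e] := h2 i iK; exists k.
Qed.

Lemma equiv_refl K : equiv K K.
Proof. by apply/equivP; exists 1%g; split=> k kK; exists k; rewrite ?act1. Qed.

Lemma equiv_sym K1 K2 : equiv K1 K2 -> equiv K2 K1.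
Proof.
case/equivP => w [h1 h2]; apply/equivP; exists w^-1%g; split=> k kK.
  by have [l lK e] := h2 k kK; exists l; rewrite // -e actK.
by have [l lK e] := h1 k kK; exists l; rewrite // -e actK.
Qed.

Lemma equiv_trans K1 K2 K3 : equiv K1 K2 -> equiv K2 K3 -> equiv K1 K3.
Proof.
case/equivP => w [h1 h2] /equivP[u [h3 h4]]; apply/equivP; exists (u * w)%g.
split=> k kK.
  have [l lK e] := h1 k kK; have [r rK e'] := h3 l lK.
  by exists r; rewrite // actM e.
have [l lK e] := h4 k kK; have [r rK e'] := h2 l lK.
by exists r; rewrite // actM e'.
Qed.

Lemma equiv_card K1 K2 : equiv K1 K2 -> #|K1| = #|K2|.
Proof. by case/existsP => w /perm_size; rewrite !size_image. Qed.

Lemma cls_eq K1 K2 : equiv K1 K2 -> cls K1 = cls K2.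
Proof.
move=> e; apply/setP => K; rewrite !inE; apply/idP/idP; apply: equiv_trans => //.
exact: equiv_sym.
Qed.

Lemma card_cls_neq0 K : #|cls K|%:R != 0 :> R.
Proof.
rewrite pnatr_eq0 -lt0n; apply/card_gt0P; exists K.
by rewrite inE equiv_refl.
Qed.

(* The number of cosets v W_J fixed by w, that is, the value at w of the
   permutation character of W on W / W_J. *)
Definition parabolic_cosets J w : nat := #|[set v in X J | (w ^ v)%g \in WJ J]|.

(** Each x is uniquely v u with v in X_J and u in W_J, and u does not affect the condition. The
    right-hand count does not refer to representatives, which makes its invariance under conjugation
    evident. *)
Lemma parabolic_cosetsE J w :
  (parabolic_cosets J w * #|WJ J| = #|[set x | (w ^ x)%g \in WJ J]|)%N.
Proof.
rewrite -cardsX -(card_in_imset (f := fun p => (p.1 * p.2)%g)); last first.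
  move=> [v u] [v' u'] /setXP[/setIdP[vX _] uJ] /setXP[/setIdP[v'X _] u'J] /= e.
  have v'E : v' = (v * (u * u'^-1))%g by rewrite mulgA e mulgK.
  have uu : (u * u'^-1)%g = 1%g.
    by apply: (X_WJ_uniq rr s_gen vX); rewrite -?v'E // groupM ?groupV.
  rewrite v'E uu mulg1; congr (_, _).
  by apply: (mulIg u'^-1%g); rewrite uu mulgV.
apply: eq_card => x; rewrite inE; apply/imsetP/idP => [[[v u]]|xJ].
  by case/setXP => /setIdP[_ vJ] uJ -> /=; rewrite conjgM groupJ.
have [u uJ xu] := X_WJ_exists rr s_gen J x.
exists ((x * u)%g, u^-1%g); last by rewrite /= mulgK.
by apply/setXP; rewrite groupV; split=> //; apply/setIdP; rewrite conjgM groupJ.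
Qed.

Lemma parabolic_cosetsJ J w g : parabolic_cosets J (w ^ g)%g = parabolic_cosets J w.
Proof.
apply/eqP; rewrite -(eqn_pmul2r (cardG_gt0 (WJ J))) !parabolic_cosetsE; apply/eqP.
rewrite -(card_imset _ (mulgI g)); apply: eq_card => x.
rewrite inE; apply/imsetP/idP => [[y]|xJ]; first by rewrite inE -conjgM => ? ->.
by exists (g^-1 * x)%g; rewrite ?mulKVg // inE -conjgM mulKVg.
Qed.

Lemma elliptic_transport T K u : elliptic s rho Pi T u -> equiv T K ->
  exists h, elliptic s rho Pi K (u ^ h)%g.
Proof.
move=> [uT ufix] /equivP[h [h1 h2]]; exists h^-1%g; split.
  have [t tT ->] := gen_word uT; elim: t tT => [|k t IHt] tT.
    by rewrite big_nil conj1g group1.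
  rewrite big_cons conjMg groupM ?IHt //; last first.
    by move=> i it; apply: tT; rewrite inE it orbT.
  have [l lK e] := h1 k (tT k (mem_head _ _)).
  by rewrite conjgE invgK mulgA (s_conj rr s_gen e) mulgK (s_in s lK).
move=> x; rewrite conjgE invgK !actM => e k kK.
have [l lT <-] := h2 k kK.
rewrite dotC (dot_actV rr s_gen) dotC; apply: ufix => //.
by rewrite -{2}e actK.
Qed.

Definition maps_to J K : {set W} :=
  [set v in X J | [forall i in K, act v (alpha i) \in Pi]].

Lemma card_pairs (I A : finType) (P : pred I) (S : I -> {set A}) :
  (\sum_(i | P i) #|S i| = #|[set p : I * A | P p.1 & p.2 \in S p.1]|)%N.
Proof.
under eq_bigr => i _ do rewrite -sum1_card.
by rewrite pair_big_dep sum1dep_card.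
Qed.

Definition simple_image v K : {set 'I_n} :=
  [set i | [exists k in K, act v (alpha k) == alpha i]].

Lemma simple_imageK v K : (forall k, k \in K -> act v (alpha k) \in Pi) ->
  simple_image v^-1%g (simple_image v K) = K.
Proof.
move=> vK; apply/setP => j; rewrite inE; apply/exists_inP/idP => [|jK].
  case=> i; rewrite inE => /exists_inP[k kK /eqP <-]; rewrite actK.
  by move/eqP/alpha_inj <-.
have /tnthP[i iE] := vK j jK.
exists i; last by rewrite -iE actK.
by rewrite inE; apply/exists_inP; exists j; rewrite // iE.
Qed.

Lemma simple_image_equiv v K : (forall k, k \in K -> act v (alpha k) \in Pi) ->
  equiv K (simple_image v K).
Proof.
move=> vK; apply/equivP; exists v; split=> k kK.
  have /tnthP[i iE] := vK k kK; exists i; rewrite // inE.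
  by apply/exists_inP; exists k; rewrite // iE.
by move: kK; rewrite inE => /exists_inP[i iK /eqP e]; exists i.
Qed.

(** The map (K, v) -> (v(K), v) is a bijection onto the pairs (K', v) with K' equivalent to [T] and
    v^-1(K') inside [J]. For each K' the element [w] is conjugate to an elliptic one of [WJ K'], so
    by [elliptic_X_equiv] the number of such v is [parabolic_cosets J w]. *)
Lemma sum_maps_to J T w g : elliptic s rho Pi T (w ^ g)%g ->
  (\sum_(K in cls T | K \subset J) #|maps_to J K| = #|cls T| * parabolic_cosets J w)%N.
Proof.
move=> ell.
pose S K := [set v in X J |
  [forall k in K, act v^-1%g (alpha k) \in [seq alpha j | j in J]]].
transitivity (\sum_(K in cls T) #|S K|)%N; last first.
  rewrite -sum_nat_const; apply: eq_bigr => K; rewrite inE => TK.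
  have [h ellK] := elliptic_transport ell TK.
  rewrite -(parabolic_cosetsJ J w g) -(parabolic_cosetsJ J _ h).
  apply: eq_card => v; rewrite !in_set; apply: andb_id2l => vX.
  by rewrite (elliptic_X_equiv rr s_gen ellK) // inE.
rewrite !card_pairs.
pose phi (p : {set 'I_n} * W) := (simple_image p.2 p.1, p.2).
have clsT K K' : equiv K K' -> (K \in cls T) = (K' \in cls T).
  move=> e; rewrite !inE; apply/idP/idP => h; apply: (equiv_trans h) => //.
  exact: equiv_sym.
rewrite -(card_in_imset (f := phi)); last first.
  move=> [K v] [K' v'] /setIdP[_ /setIdP[_ /forall_inP vK]].
  move=> /setIdP[_ /setIdP[_ /forall_inP vK']] [e ev].
  rewrite /= in vK vK' e ev; rewrite -ev in vK' e *.
  by rewrite -(simple_imageK vK) e simple_imageK.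
apply: eq_card => -[K' v]; apply/imsetP/setIdP => /=.
  case=> -[K v'] /setIdP[/= /andP[KT KJ] /setIdP[vX /forall_inP vK]] [-> ->].
  split; first by rewrite -(clsT K) //; apply: simple_image_equiv.
  apply/setIdP; split=> //; apply/forall_inP => i.
  rewrite inE => /exists_inP[k kK /eqP <-]; rewrite actK image_f //.
  exact: (subsetP KJ).
case=> K'T /setIdP[vX /forall_inP vK'].
have vK i : i \in K' -> act v^-1%g (alpha i) \in Pi.
  by move=> /vK' /imageP[j _ ->]; apply: mem_tnth.
exists (simple_image v^-1%g K', v); last first.
  by rewrite /phi /= -{2}(invgK v) simple_imageK.
apply/setIdP; split=> /=.
  rewrite -(clsT K') ?K'T; last exact: simple_image_equiv.
  apply/subsetP => j; rewrite inE => /exists_inP[k kK /eqP e].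
  by have /imageP[l lJ] := vK' k kK; rewrite e => /alpha_inj ->.
apply/setIdP; split=> //; apply/forall_inP => j; rewrite inE.
by case/exists_inP => k kK /eqP <-; rewrite actKV mem_tnth.
Qed.

Lemma maps_to_self K : (0 < #|maps_to K K|)%N.
Proof.
apply/card_gt0P; exists 1%g; apply/setIdP; split.
  rewrite (mem_X rr s_gen); apply/forall_inP => i _.
  by rewrite act1 (simple_pos rr).
by apply/forall_inP => i _; rewrite act1 mem_tnth.
Qed.

Lemma muE K J : mu rho Phi Pi K J =
  if K \subset J then #|maps_to J K|%:R / #|cls K|%:R else 0.
Proof. by []. Qed.

(** The enumeration of subsets need not be compatible with inclusion, so triangularity is used in
    another form: a row vector in the kernel vanishes at [J] by induction on [#|J|]. *)
Lemma mu_mx_unit : mu_mx rho Phi Pi \in unitmx.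
Proof.
rewrite unitmxE unitfE; apply/negP => /det0P[v v0 vmu].
case/eqP: v0; apply/rowP => j; rewrite mxE -[j]enum_valK.
set J := enum_val j; have [k] := ubnP #|J|.
elim: k J => // k IHk J Jk.
have /rowP/(_ (enum_rank J)) := vmu; rewrite !mxE (bigD1 (enum_rank J)) //=.
rewrite big1 => [|i iJ]; last first.
  rewrite !mxE enum_rankK muE; case: ifP => [sub|]; last by rewrite mulr0.
  rewrite -(enum_valK i) IHk ?mul0r //; apply: leq_trans (_ : (#|J| <= k)%N) => //.
  apply: proper_card; rewrite properEneq sub andbT.
  by apply: contraNneq iJ => <-; rewrite enum_valK.
rewrite addr0 !mxE enum_rankK muE subxx => /eqP; rewrite mulf_eq0 => /orP[/eqP //|].
by rewrite mulf_eq0 invr_eq0 (negPf (card_cls_neq0 _)) pnatr_eq0 eqn0Ngt maps_to_self.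
Qed.

(** * Parabolic types and the row of beta at the empty set *)

Lemma parabolic_type_subproof : {typ : W -> {set 'I_n} |
  forall w, exists g, elliptic s rho Pi (typ w) (w ^ g)%g}.
Proof.
exists (fun w => sval (cid (elliptic_exists rr s_gen w))) => w.
exact: (svalP (cid (elliptic_exists rr s_gen w))).
Qed.

Definition parabolic_type := sval parabolic_type_subproof.

Lemma parabolic_typeP w : exists g, elliptic s rho Pi (parabolic_type w) (w ^ g)%g.
Proof. exact: (svalP parabolic_type_subproof). Qed.

Lemma codim_parabolic_type w : codim_fix (rho w) = #|parabolic_type w|.
Proof.
have [g /(elliptic_codim rr) <-] := parabolic_typeP w.
have gu x : rho x \in unitmx by apply: repr_mx_unit; rewrite inE.
have -> : rho w = rho g *m rho (w ^ g)%g *m rho g^-1%g.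
  by rewrite -!rhoM conjgE !mulgA mulgV mul1g mulgK.
have -> : codim_fix (rho g *m rho (w ^ g)%g *m rho g^-1%g) =
    \rank (rho g *m (1%:M - rho (w ^ g)%g) *m rho g^-1%g).
  rewrite /codim_fix mulmxBr mulmx1 mulmxBl -[rho g *m rho g^-1%g]rhoM mulgV.
  by rewrite repr_mx1.
by rewrite mxrankMfree ?row_free_unit ?gu // eqmxMfull ?row_full_unit ?gu.
Qed.

Lemma sum_sgn_parabolic J : \sum_(u in WJ J) sgn rho u = (J == set0)%:R.
Proof.
have [->|/set0Pn[j jJ]] := eqVneq J set0.
  by rewrite imset0 gen0 big_set1 sgn1.
have sj : sgn rho (s j) = -1.
  by rewrite /sgn (rho_s rr) det_reflmx ?(simple_neq0 rr).
set S := \sum_(u in _) _.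
have : S = - S.
  rewrite {1}/S (reindex_inj (mulgI (s j))) -sumrN; apply: eq_big => [u|u _].
    by rewrite groupMl // (s_in s jJ).
  by rewrite sgnM sj mulN1r.
move/eqP; rewrite -addr_eq0 -mulr2n mulrn_eq0 /=.
by move/eqP.
Qed.

(** After exchanging the sums, conjugation by v, which preserves the sign, makes each inner sum one
    over W_J. For [J] empty every element of [W] is a representative, whence the factor [#|W|]. *)
Lemma sum_sgn_parabolic_cosets J :
  \sum_w sgn rho w * (parabolic_cosets J w)%:R = (J == set0)%:R * #|W|%:R.
Proof.
have orth := orth_rho rr s_gen.
transitivity (\sum_(v in X J) \sum_(u in WJ J) sgn rho u).
  transitivity (\sum_w \sum_(v in X J) if (w ^ v)%g \in WJ J then sgn rho w else 0).
    apply: eq_bigr => w _; rewrite /parabolic_cosets -sum1dep_card natr_sum mulr_sumr.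
    rewrite big_mkcondr /=; apply: eq_bigr => v _.
    by case: ifP; rewrite ?mulr1.
  rewrite exchange_big; apply: eq_bigr => v _ /=.
  rewrite -big_mkcond (reindex_inj (conjg_inj v^-1%g)) /=.
  apply: eq_big => [u|u _]; first by rewrite conjgKV.
  by rewrite conjgE invgK !sgnM sgnV // mulrCA sgn_sqr // mulr1.
rewrite sumr_const sum_sgn_parabolic; case: eqP => [->|_]; last first.
  by rewrite mul0rn mul0r.
rewrite mul1r -mulr_natr mul1r; congr (_%:R); rewrite -cardsT; apply: eq_card => v.
rewrite (mem_X rr s_gen) inE; apply/forall_inP => j.
by rewrite inE.
Qed.

(* Turns out to be the row of beta indexed by the empty set. *)
Definition type_mass K : R :=
  #|W|%:R^-1 * \sum_(w | equiv (parabolic_type w) K) sgn rho w.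

Lemma sum_type_mass (h : {set 'I_n} -> R) :
  \sum_K type_mass K * h K = #|W|%:R^-1 *
    \sum_w sgn rho w * \sum_(K in cls (parabolic_type w)) h K.
Proof.
under eq_bigr => K _ do rewrite -mulrA mulr_suml.
rewrite -mulr_sumr; congr (_ * _).
under eq_bigr => K _ do rewrite big_mkcond /=.
rewrite exchange_big; apply: eq_bigr => w _ /=.
rewrite mulr_sumr -big_mkcond /=; apply: eq_bigl => K.
by rewrite inE.
Qed.

Lemma sum_type_mass_mu J :
  \sum_K type_mass K * mu rho Phi Pi K J = (J == set0)%:R.
Proof.
rewrite sum_type_mass.
have W0 := cardW_neq0 R W.
apply: (mulfI W0); rewrite mulrA mulfV // mul1r mulrC -sum_sgn_parabolic_cosets.
apply: eq_bigr => w _; congr (_ * _); set T := parabolic_type w.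
have [g ell] := parabolic_typeP w.
have c0 := card_cls_neq0 T.
apply: (mulfI c0); rewrite -natrM -(sum_maps_to J ell) -/T natr_sum mulr_sumr.
rewrite [RHS]big_mkcondr /=; apply: eq_bigr => K; rewrite inE => TK.
rewrite muE -(cls_eq TK); case: ifP => _; last by rewrite mulr0.
by rewrite mulrCA mulfV // mulr1.
Qed.

Lemma beta_set0 J : beta rho Phi Pi set0 J = type_mass J.
Proof.
pose b : 'rV[R]_#|{set 'I_n}| := \row_k type_mass (enum_val k).
have : b *m mu_mx rho Phi Pi = delta_mx 0 (enum_rank set0).
  apply/rowP => j; rewrite !mxE -[RHS]/((j == enum_rank set0)%:R).
  have -> : (j == enum_rank set0) = (enum_val j == set0).
    by rewrite -(inj_eq enum_val_inj) enum_rankK.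
  rewrite -sum_type_mass_mu (reindex (@enum_val _ {set 'I_n})) /=.
    by apply: eq_bigr => k _; rewrite !mxE.
  by exists enum_rank => K _; rewrite ?enum_rankK ?enum_valK.
move/(congr1 (mulmx^~ (invmx (mu_mx rho Phi Pi)))); rewrite mulmxK ?mu_mx_unit //.
rewrite -rowE => /rowP/(_ (enum_rank J)); rewrite !mxE enum_rankK => ->.
by [].
Qed.

(** * Evaluation at the longest element *)

Lemma sum_classes (h : {set 'I_n} -> R) :
  \sum_(lam in simple_classes rho Pi) \sum_(K in lam) h K = \sum_K h K.
Proof.
have er : {in [set: {set 'I_n}] & &, equivalence_rel equiv}.
  move=> K1 K2 K3 _ _ _; split=> [|e]; first exact: equiv_refl.
  by have /setP/(_ K3) := cls_eq e; rewrite !inE.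
have := equivalence_partitionP er; rewrite -/(simple_classes rho Pi).
case/and3P => /eqP cov triv _.
rewrite -big_trivIset //= cov; apply: eq_bigl => K.
by rewrite inE.
Qed.

Lemma mem_simple_classes lam K : lam \in simple_classes rho Pi -> K \in lam ->
  lam = cls K.
Proof.
case/imsetP => K0 _ ->; rewrite !inE /= => K0K; rewrite -(cls_eq K0K).
by apply/setP => L; rewrite !inE.
Qed.

Lemma class_rankE lam K : lam \in simple_classes rho Pi -> K \in lam ->
  class_rank lam = #|K|.
Proof.
move=> lamP Klam; rewrite /class_rank.
case: pickP => [L Llam|/(_ K)]; last by rewrite Klam.
have := Llam; rewrite (mem_simple_classes lamP Klam) inE => KL.
exact/esym/equiv_card.
Qed.

Lemma e_longest w0 J : (forall i, neg_root Phi Pi (act w0 (alpha i))) ->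
  e_ rho Phi Pi J w0 = type_mass J.
Proof.
move=> w0neg; rewrite -beta_set0 /e_ sum_ffunE (bigD1 set0) ?sub0set //=.
have xE K : x_ rho Phi Pi K w0 = (w0 \in X K)%:R.
  rewrite /x_ sum_ffunE; under eq_bigr => w _ do rewrite ffunE.
  case w0X: (w0 \in X K).
    rewrite (bigD1 w0) //= eqxx big1 ?addr0 // => w /andP[_ ne].
    by rewrite eq_sym (negPf ne).
  rewrite big1 // => w wX; case: eqP => // e.
  by rewrite -e w0X in wX.
rewrite big1 ?addr0 => [|K /andP[_ /set0Pn[k kK]]].
  rewrite ffunE xE (mem_X rr s_gen).
  have -> : [forall j in set0, pos_root Phi Pi (act w0 (alpha j))].
    by apply/forall_inP => j; rewrite inE.
  by rewrite -[RHS]mulr1.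
rewrite ffunE xE (mem_X rr s_gen).
have -> : [forall j in K, pos_root Phi Pi (act w0 (alpha j))] = false.
  apply/negbTE/forall_inPn; exists k => //.
  by rewrite -(nneg_pos rr) ?w0neg // (neg_in (w0neg k)).
exact: mulr0.
Qed.

(** When the sum is regrouped by [w], all members of the class of its type contribute the same term,
    and the factor 1/|lambda| of [e_class] cancels their number. *)
Lemma M_longest w0 (x : R) : (forall i, neg_root Phi Pi (act w0 (alpha i))) ->
  x != 0 ->
  M_ rho Phi Pi x w0 =
    (\sum_w sgn rho w * x ^+ (n - codim_fix (rho w))) / (x ^+ n * #|W|%:R).
Proof.
move=> w0neg x0; rewrite /M_ sum_ffunE.
transitivity (\sum_(lam in simple_classes rho Pi) \sum_(K in lam)
    type_mass K * ((x ^+ #|K|)^-1 * #|cls K|%:R^-1)).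
  apply: eq_bigr => lam lamP; rewrite ffunE /e_class sum_ffunE.
  transitivity ((x ^+ class_rank lam)^-1 * \sum_(K in lam) #|lam|%:R^-1 * type_mass K).
    congr (_ * _); apply: eq_bigr => K _; rewrite ffunE e_longest //.
  rewrite mulr_sumr; apply: eq_bigr => K Klam.
  rewrite (class_rankE lamP Klam) -(mem_simple_classes lamP Klam).
  by rewrite mulrA mulrC.
rewrite sum_classes sum_type_mass invfM [in RHS]mulrA [RHS]mulrC mulr_suml.
congr (_ * _).
apply: eq_bigr => w _; rewrite -mulrA; congr (_ * _).
set T := parabolic_type w.
rewrite (eq_bigr (fun=> (x ^+ #|T|)^-1 * #|cls T|%:R^-1)) => [|K]; last first.
  by rewrite inE => TK; rewrite (equiv_card TK) (cls_eq TK).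
rewrite sumr_const -[LHS]mulr_natr -mulrA mulVf ?card_cls_neq0 // mulr1.
have cn := codim_fix_le (rho w); rewrite codim_parabolic_type -/T in cn *.
apply: (mulfI (expf_neq0 #|T| x0)); rewrite mulfV ?expf_neq0 //.
by rewrite mulrA -exprD subnKC // mulfV // expf_neq0.
Qed.

End Descents.

Theorem theorem4 (R : realType) (n : nat) (W : finGroupType) (s : 'I_n -> W)
  (rho : mx_representation R [set: W] n)
  (Phi : seq 'cV[R]_n) (Pi : n.-tuple 'cV[R]_n)
  (m : 'I_n -> nat) (w0 : W) (x : R) :
  coxeter_system s ->
  reflection_representation rho s Phi Pi ->
  exponents rho m ->
  longest s w0 ->
  x != 0 ->
  M_ rho Phi Pi x w0 = (\prod_(i < n) (x - (m i)%:R)) / (x ^+ n * #|W|%:R).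
Proof.
move=> cox rr [f [[f_inv f_gen f_indep] f_homog]] w0max x0.
have s_gen := cox_generated cox.
rewrite (M_longest rr s_gen) // => [|i]; last exact: (longest_neg rr s_gen).
by rewrite (sum_sgn_fix_dim (simple_neq0 rr) (rho_s rr) (words s_gen)
  (refl_faithful rr) f_inv f_gen f_indep f_homog).
Qed.
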